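(* For each fixed integer $r\ge1$, as $n\to\infty$, $$D_r(n;z)=n^z\bigl(K_r(z)+o(1)\bigr)$$ locally uniformly for $z$ in a (complex) neighborhood of $1$. The asymptotic remains valid after any fixed number of differentiations with respect to $z$: writing $D_r(n;z)=n^z(K_r(z)+\varepsilon_n(z))$, for every fixed $k\ge0$ one has $\varepsilon_n^{(k)}(z)\to0$ locally uniformly near $z=1$. In particular, $$D_r(n;1)\sim C_r\,n\qquad(n\to\infty).$$
   Context: For a partition $\mu=(\mu_1,\ldots,\mu_i)$, $\mu\vdash j$ means $\mu_1+\cdots+\mu_i=j$ and $\ell(\mu)=i$ is the number of positive parts. $m_\mu(x_1,\ldots,x_n)$ is the monomial symmetric polynomial: the sum of all distinct monomials obtained by assigning the exponents $\mu_1,\ldots,\mu_i$ to distinct variables among $x_1,\ldots,x_n$ ($0$ if $i>n$). For $n\ge1$, $$E_{i,j}(n)=\sum_{\mu\vdash j,\ \ell(\mu)=i}\frac{m_\mu(1,1/2,\ldots,1/n)}{\mu_1!\cdots\mu_i!},\qquad E_{0,0}(n)=1,$$ (empty sums are $0$), and for $r\ge1$ $$D_r(n;z)=\sum_{i\ge0}E_{i,i+r-1}(n)\,z^i,$$ a polynomial in $z$. Put $\phi_q(u)=(e^{u/q}-1)/u$ with $\phi_q(0)=1/q$, and, for $u$ near $0$ and $z$ near $1$, $$R(u,z)=\prod_{q=1}^\infty\frac{1+z\phi_q(u)}{1+z/q},$$ which converges locally uniformly there. Define $$K_r(z)=\frac{1}{\Gamma(1+z)}\,[u^{r-1}]R(u,z),\qquad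 C_r=[u^{r-1}]R(u,1)=[u^{r-1}]\prod_{q=1}^\infty\frac{q}{q+1}\left(1+\frac{e^{u/q}-1}{u}\right),$$ where $[u^{r-1}]$ is the coefficient of $u^{r-1}$ in the Taylor expansion at $u=0$. *)

(* Defs.v *)
From HB Require Import structures.
From mathcomp Require Import all_boot all_order all_algebra.
From mathcomp Require Import complex.
From mathcomp Require Import all_classical all_reals all_analysis.

Set Implicit Arguments.
Unset Strict Implicit.
Unset Printing Implicit Defensive.

Import Order.TTheory GRing.Theory Num.Theory.
Import numFieldNormedType.Exports.

Local Open Scope classical_set_scope.
Local Open Scope complex_scope.
Local Open Scope ring_scope.

(* Typed as a numFieldType so that R[i] inherits its modulus topology and its
   normed space structure over itself from numFieldNormedType; [derive1n] on
   functions CC R -> CC R is then iterated complex differentiation. *)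
Definition CC (R : realType) : numFieldType := R[i].

Section Combinatorics.
Variable F : fieldType.

Definition is_partition (j : nat) (mu : seq nat) : bool :=
  [&& sorted geq mu, 0%N \notin mu & sumn mu == j].

(* Each distinct monomial is given by its exponent vector [a]; it occurs in
   m_mu iff the nonzero exponents are the parts of mu in some order. *)
Definition monomial_sym (n : nat) (x : 'I_n -> F) (mu : seq nat) : F :=
  \sum_(a : {ffun 'I_n -> 'I_(sumn mu).+1}
        | perm_eq [seq e <- [seq val (a k) | k : 'I_n] | e != 0%N] mu)
    \prod_(k < n) x k ^+ a k.

(* A partition of j has parts at most j, so tuples over 'I_j.+1 suffice. *)
Definition Eij (i j n : nat) : F :=
  \sum_(mu : i.-tuple 'I_j.+1 | is_partition j (map val mu))
    monomial_sym (fun k : 'I_n => k.+1%:R^-1) (map val mu)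
      / \prod_(p <- map val mu) p`!%:R.

Lemma monomial_sym_gt (n : nat) (x : 'I_n -> F) (mu : seq nat) :
  (n < size mu)%N -> monomial_sym x mu = 0.
Proof.
move=> ltn; rewrite /monomial_sym big_pred0 // => a; apply/negP => /perm_size.
move=> eqs; move: ltn; rewrite -eqs ltnNge => /negP; apply.
by rewrite size_filter (leq_trans (count_size _ _)) // size_map size_enum_ord.
Qed.

Lemma Eij00 (n : nat) : Eij 0 0 n = 1.
Proof.
rewrite /Eij (big_pred1 [tuple]) /=; last by move=> m; rewrite [m]tuple0 /= eqxx.
rewrite big_nil divr1 /monomial_sym (big_pred1 [ffun => ord0]) /=.
  by rewrite big1 // => k _; rewrite ffunE.
move=> a; have -> : a = [ffun => ord0].
  by apply/ffunP => k; rewrite ffunE [a k]ord1.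
rewrite /= [RHS]eqxx.
suff -> : [seq e <- [seq val ([ffun=> ord0 : 'I_1] k) | k : 'I_n] | e != 0%N]
          = [::] by [].
apply/eqP; rewrite -[_ == _]negbK -has_filter.
by apply/hasPn => x /mapP[k _ ->]; rewrite ffunE.
Qed.

Lemma Eij_gt (i j n : nat) : (n < i)%N -> Eij i j n = 0.
Proof.
move=> ltni; rewrite /Eij big1 // => mu _.
by rewrite monomial_sym_gt ?mul0r // size_map size_tuple.
Qed.

(* The terms with i > n vanish by [Eij_gt]. *)
Definition Dr (r n : nat) (z : F) : F :=
  \sum_(i < n.+1) Eij i (i + r - 1) n * z ^+ i.

End Combinatorics.

Section Analysis.
Variable R : realType.

Definition cexp (z : CC R) : CC R :=
  let: x +i* y := z in (expR x * cos y) +i* (expR x * sin y).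

(* [t ^ z], for [t > 0] *)
Definition cpow (t : R) (z : CC R) : CC R := cexp (z * (ln t)%:C).

(* Euler's integral for Re z > 0, split into real and imaginary parts because
   the Lebesgue integral is available for real-valued functions only. *)
Definition Gamma (z : CC R) : CC R :=
  let f (t : R) := cpow t (z - 1) * (expR (- t))%:C in
  (\int[lebesgue_measure]_(t in `]0%R, +oo[) complex.Re (f t))
  +i* (\int[lebesgue_measure]_(t in `]0%R, +oo[) complex.Im (f t)).

Definition phi (q : nat) (u : CC R) : CC R :=
  if u == 0 then q%:R^-1 else (cexp (u / q%:R) - 1) / u.

Definition Rprod (u z : CC R) : CC R :=
  lim ((fun N : nat =>
    \prod_(1 <= q < N.+1) ((1 + z * phi q u) / (1 + z / q%:R))) @ \oo).

Definition taylor_coef (m : nat) (f : CC R -> CC R) : CC R :=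
  derive1n m f 0 / m`!%:R.

Definition Kr (r : nat) (z : CC R) : CC R :=
  (Gamma (1 + z))^-1 * taylor_coef (r - 1) (fun u => Rprod u z).

Definition Cr (r : nat) : CC R := taylor_coef (r - 1) (fun u => Rprod u 1).

Definition locally_uniformly (U : set (CC R)) (f : nat -> CC R -> CC R)
    (g : CC R -> CC R) : Prop :=
  forall z, U z -> exists2 V, nbhs z V & {uniform V, f @ \oo --> g}.

End Analysis.

(* Main.v *)
Require Import Defs.
From mathcomp Require Import all_boot all_order all_algebra.
From mathcomp Require Import complex.
From mathcomp Require Import all_classical all_reals all_analysis.
From mathcomp Require Import separable cyclotomic cyclic measurable_realfun.
From mathcomp Require Import ring lra.
Import Order.TTheory GRing.Theory Num.Theory.
Import UnityRootTheory.
Import numFieldNormedType.Exports.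
Local Open Scope classical_set_scope.
Local Open Scope complex_scope.
Local Open Scope ring_scope.

Set Implicit Arguments.
Unset Strict Implicit.
Unset Printing Implicit Defensive.

(** The polynomial [Dr r n z] is the coefficient of [u ^ (r - 1)] in the finite
    product of the [1 + z phi_q (u)], [1 <= q <= n]: expanding the product
    chooses an exponent for each variable [1 / q], and collecting exponent
    vectors by their nonzero parts gives the sums over partitions
    ([Dr_coef]). Write this product as the product of the [1 + z / q] times the
    [n]-th partial product of [R (u, z)].

    For [z] in the disc of centre [1] and radius [1/2] and [u] in the unit disc,
    the factors of [R] are [1 + O (1 / q ^ 2)], so the partial products converge
    to [R] uniformly, with error [O (1 / n)]; a Cauchy estimate transfers this to
    the Taylor coefficients ([taylor_Rprod_rate]). Likewise the product of the
    [1 + z / q], multiplied by [n ^ (- z)], converges with error [O (1 / n)]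
    ([gauss_part_cvg]), and its limit is [1 / Gamma (1 + z)] ([invr_Gamma]):
    its reciprocal is, up to a factor tending to [1], the integral of
    [t ^ z (1 - t / n) ^ n] over [0, n], which tends to Euler's integral by
    dominated convergence. Hence [Dr r n z * n ^ (- z)] converges to [Kr r z]
    with error [O (1 / n)], uniformly in [z] ([remainder_rate]).

    Convergence of all derivatives is the Weierstrass theorem. Instead of
    Cauchy's integral formula, the proof uses the functions that are uniform
    limits of polynomials on a disc ([disc_algebra]). For polynomials, Cauchy's
    inequalities follow by averaging over roots of unity ([coef_le_sup]), and
    they pass to uniform limits together with the existence of all derivatives
    ([disc_algebra_derive1n]). The remainder belongs to this class and is
    [O (1 / n)] on the disc of radius [1/2]; therefore each of its derivatives is
    [O (1 / n)] on the disc of radius [1/4].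

    At [z = 1] the factor [1 / Gamma (2)] equals [1], and the asymptotic
    equivalence requires [Cr r] to be nonzero; this holds because all
    coefficients involved are nonnegative ([Cr_neq0]). *)

(** * The modulus of a complex number as a real number *)

Section RealEmbedding.
Variable R : realType.
Implicit Types (x y : R).

Lemma realCN x : (- x)%:C = - x%:C :> CC R.
Proof. exact: (rmorphN (real_complex R)). Qed.

Lemma realCB x y : (x - y)%:C = x%:C - y%:C :> CC R.
Proof. exact: (rmorphB (real_complex R)). Qed.

Lemma realCM x y : (x * y)%:C = x%:C * y%:C :> CC R.
Proof. exact: (rmorphM (real_complex R)). Qed.

Lemma realCV x : (x^-1)%:C = (x%:C)^-1 :> CC R.
Proof. exact: (fmorphV (real_complex R)). Qed.

Lemma realCX x n : (x ^+ n)%:C = x%:C ^+ n :> CC R.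
Proof. exact: (rmorphXn (real_complex R)). Qed.

Lemma realC_nat n : (n%:R : R)%:C = n%:R :> CC R.
Proof. exact: (rmorph_nat (real_complex R)). Qed.

End RealEmbedding.

Section Modulus.
Variable R : realType.
Implicit Types (x y z : CC R) (e : R).

(** The norm of [CC R] takes its values in [CC R] itself, where the order is
    partial; a real-valued modulus gives access to real arithmetic. *)
Definition cabs (z : CC R) : R := complex.Re (`|z| : R[i]).

Lemma normCE z : `|z| = (cabs z)%:C.
Proof.
rewrite /cabs; have /RRe_real : (`|z| : R[i]) \is Num.real by exact: normr_real.
by move=> ->.
Qed.

Lemma cabs_normc z : cabs z = Normc.normc z.
Proof. by case: z. Qed.

Lemma cabs0 : cabs 0 = 0.
Proof. by rewrite /cabs normr0. Qed.

Lemma cabs1 : cabs 1 = 1.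
Proof. by rewrite /cabs normr1. Qed.

Lemma cabsM x y : cabs (x * y) = cabs x * cabs y.
Proof. by rewrite !cabs_normc Normc.normcM. Qed.

Lemma cabsN x : cabs (- x) = cabs x.
Proof. by rewrite /cabs normrN. Qed.

Lemma cabsB x y : cabs (x - y) = cabs (y - x).
Proof. by rewrite -cabsN opprB. Qed.

Lemma cabs_ge0 z : 0 <= cabs z.
Proof. by rewrite -lecR -normCE normr_ge0. Qed.

Lemma cabsD x y : cabs (x + y) <= cabs x + cabs y.
Proof. by rewrite -lecR rmorphD /= -!normCE ler_normD. Qed.

Lemma cabs_tri x y z : cabs (x - z) <= cabs (x - y) + cabs (y - z).
Proof. by rewrite (le_trans _ (cabsD _ _)) // addrA subrK. Qed.

Lemma cabs_triB x y : cabs x <= cabs y + cabs (x - y).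
Proof. by rewrite -{1}(subrK y x) addrC cabsD. Qed.

Lemma cabs_eq0 z : (cabs z == 0) = (z == 0).
Proof. by rewrite -(normr_eq0 z) normCE; apply/eqP/eqP => [->|[]]. Qed.

Lemma cabs_gt0 z : (0 < cabs z) = (z != 0).
Proof. by rewrite lt_neqAle cabs_ge0 andbT eq_sym cabs_eq0. Qed.

Lemma cabsV z : cabs z^-1 = (cabs z)^-1.
Proof. by rewrite !cabs_normc Normc.normcV. Qed.

Lemma cabsX z n : cabs (z ^+ n) = cabs z ^+ n.
Proof. by elim: n => [|n IH]; rewrite ?expr0 ?cabs1 // !exprS cabsM IH. Qed.

Lemma cabs_real e : cabs e%:C = `|e|.
Proof. by rewrite cabs_normc /= expr0n addr0 sqrtr_sqr. Qed.

Lemma cabs_nat n : cabs n%:R = n%:R.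
Proof. by rewrite /cabs normr_nat -(rmorph_nat (real_complex R)). Qed.

Lemma cabs_sum (I : Type) (s : seq I) (P : pred I) (F : I -> CC R) :
  cabs (\sum_(i <- s | P i) F i) <= \sum_(i <- s | P i) cabs (F i).
Proof.
elim/big_rec2: _ => [|i y x _ IH]; first by rewrite cabs0.
by rewrite (le_trans (cabsD _ _)) // lerD2l.
Qed.

Lemma cabs_Re z : `|complex.Re z| <= cabs z.
Proof. by have := normc_ge_Re (z : R[i]); rewrite normCE lecR. Qed.

Lemma cabs_Im z : `|complex.Im z| <= cabs z.
Proof.
rewrite cabs_normc; case: z => a b /=.
by rewrite -(sqrtr_sqr b) ler_wsqrtr // lerDr sqr_ge0.
Qed.

Lemma cabs_ReIm z : cabs z <= `|complex.Re z| + `|complex.Im z|.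
Proof.
case: z => a b /=.
have -> : (a +i* b : CC R) = a%:C + (0 +i* b) by apply/eqP; rewrite eq_complex /= addr0 add0r !eqxx.
rewrite (le_trans (cabsD _ _)) // cabs_real lerD2l.
by rewrite cabs_normc /= expr0n add0r sqrtr_sqr.
Qed.

(** The scalars of [CC R], hence the radii of its balls, are complex numbers;
    the positive ones are exactly the positive reals. *)
Lemma nbhs_cabsP z (A : set (CC R)) :
  nbhs z A <-> exists2 e : R, 0 < e & forall w, cabs (w - z) < e -> A w.
Proof.
rewrite -nbhs_ballE; split.
- move=> [d /= d0 dA].
  have dr : (d : R[i]) \is Num.real by apply: ger0_real; exact: ltW.
  have dE : d = (complex.Re (d : R[i]))%:C by rewrite (RRe_real dr).
  exists (complex.Re (d : R[i])).
    by move: d0; rewrite {1}dE ltcR.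
  move=> w wz; apply: dA; rewrite -ball_normE /ball_ /= dE normCE.
  by rewrite ltcR cabsB.
- move=> [e e0 eA]; exists e%:C => /=; first by rewrite ltcR.
  move=> w; rewrite -ball_normE /ball_ /= normCE ltcR cabsB; exact: eA.
Qed.

Lemma cvg_cabsP (u : nat -> CC R) z :
  (u @ \oo --> z) <->
  (forall e, 0 < e -> exists N, forall n, (N <= n)%N -> cabs (u n - z) < e).
Proof.
split.
- move=> uz e e0.
  have /uz : nbhs z [set w | cabs (w - z) < e] by apply/nbhs_cabsP; exists e.
  by case=> N _ NP; exists N => n Nn; apply: NP.
- move=> H A /nbhs_cabsP [e e0 eA]; have [N NP] := H _ e0.
  by exists N => // n /= Nn; apply: eA; apply: NP.
Qed.

Lemma cvg_rate (u : nat -> CC R) z (B : R) :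
  (forall n, cabs (u n - z) <= B / n.+1%:R) -> u @ \oo --> z.
Proof.
move=> uB; apply/cvg_cabsP => e e0.
have [N BN] : exists N, B / N.+1%:R < e.
  have B0 : 0 <= B.
    have := uB 0%N; rewrite divr1; apply: le_trans; exact: cabs_ge0.
  have := archi_boundP (divr_ge0 B0 (ltW e0)).
  set N := Num.bound _ => H; exists N.
  rewrite ltr_pdivrMr ?ltr0n // mulrC -ltr_pdivrMr //.
  by apply: lt_le_trans H _; rewrite ler_nat.
exists N => n Nn; apply: le_lt_trans (uB n) (le_lt_trans _ BN).
have B0 : 0 <= B.
  have := uB 0%N; rewrite divr1; apply: le_trans; exact: cabs_ge0.
by rewrite ler_wpM2l // lef_pV2 ?posrE ?ltr0n // ler_nat ltnS.
Qed.

(** Completeness of the complex numbers, with the rate carried over to the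
    limit. It follows from the completeness of the reals applied to both
    coordinates. *)
Lemma cauchy_rate (u : nat -> CC R) (B : R) :
  (forall n m, (n <= m)%N -> cabs (u m - u n) <= B / n.+1%:R) ->
  exists l, forall n, cabs (u n - l) <= B / n.+1%:R.
Proof.
move=> uB.
have B0 : 0 <= B.
  have := uB 0%N 0%N isT; rewrite divr1; apply: le_trans; exact: cabs_ge0.
have real_lim (v : nat -> R) :
    (forall n m, (n <= m)%N -> `|v m - v n| <= B / n.+1%:R) ->
    exists l : R, v @ \oo --> l.
  move=> vB; suff : cvgn v by move=> ?; exists (limn v).
  apply/cauchy_cvgP/cauchy_exP => e /= e0.
  have [N BN] : exists N, B / N.+1%:R < e.
    have := archi_boundP (divr_ge0 B0 (ltW e0)).
    set N := Num.bound _ => H; exists N.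
    rewrite ltr_pdivrMr ?ltr0n // mulrC -ltr_pdivrMr //.
    by apply: lt_le_trans H _; rewrite ler_nat.
  exists (v N); exists N => // n /= Nn.
  by rewrite -ball_normE /ball_ /= distrC (le_lt_trans (vB _ _ Nn)).
have ReB z w : complex.Re z - complex.Re w = complex.Re (z - w).
  by case: z w => [? ?] [? ?].
have ImB z w : complex.Im z - complex.Im w = complex.Im (z - w).
  by case: z w => [? ?] [? ?].
have [|a ua] := real_lim (fun n => complex.Re (u n)).
  by move=> n m nm; rewrite ReB (le_trans (cabs_Re _)) ?uB.
have [|b ub] := real_lim (fun n => complex.Im (u n)).
  by move=> n m nm; rewrite ImB (le_trans (cabs_Im _)) ?uB.
exists (a +i* b) => n; apply/ler_addgt0Pr => e e0.
have /cvgrPdist_lt/(_ _ (divr_gt0 e0 (ltr0n R 2))) [N1 _ H1] := ua.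
have /cvgrPdist_lt/(_ _ (divr_gt0 e0 (ltr0n R 2))) [N2 _ H2] := ub.
pose m := maxn n (maxn N1 N2).
have nm : (n <= m)%N by rewrite leq_maxl.
have /= h1 := H1 m (leq_trans (leq_maxl _ _) (leq_maxr _ _)).
have /= h2 := H2 m (leq_trans (leq_maxr _ _) (leq_maxr _ _)).
apply: le_trans (cabs_tri _ (u m) _) _.
rewrite lerD // 1?cabsB ?uB //.
apply: le_trans (cabs_ReIm _) _.
by rewrite -!ReB -!ImB /=; lra.
Qed.

(** A quadratic remainder is a convenient sufficient condition for complex
    differentiability: it survives pointwise limits. *)
Lemma derive1_quadratic (f : CC R -> CC R) z l (d C : R) :
  0 < d -> (forall h, cabs h <= d ->
             cabs (f (h + z) - f z - h * l) <= C * cabs h ^+ 2) ->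
  derivable f z 1 /\ derive1 f z = l.
Proof.
move=> d0 fC.
suff H : (fun h : CC R => h^-1 *: (f (h + z) - f z)) @ 0^' --> l.
  split; last first.
    rewrite /derive1; apply/cvg_lim; last exact: H.
    exact: norm_hausdorff.
  apply/cvg_ex; exists l; apply: cvg_trans H.
  apply: near_eq_cvg; near=> h.
  by rewrite /= [h%:A]mulr1.
move=> A /nbhs_cabsP[e e0 eA].
have C1 : 0 < `|C| + 1 by rewrite ltr_wpDl.
pose r := Num.min d (e / (`|C| + 1)).
have r0 : 0 < r by rewrite lt_min d0 divr_gt0.
suff : (0 : CC R)^' [set h | cabs h < r /\ h != 0].
  apply: filterS => h [hr h0].
  apply: eA.
  have -> : h^-1 *: (f (h + z) - f z) - l = h^-1 * (f (h + z) - f z - h * l).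
    by rewrite [RHS]mulrBr mulKf.
  rewrite cabsM cabsV.
  have hp : 0 < cabs h by rewrite cabs_gt0.
  rewrite mulrC ltr_pdivrMr //.
  have /fC /le_lt_trans : cabs h <= d.
    by move: hr; rewrite lt_min => /andP[/ltW].
  apply.
  have : cabs h < e / (`|C| + 1) by move: hr; rewrite lt_min => /andP[].
  rewrite ltr_pdivlMr // => he.
  have : C <= `|C| by exact: ler_norm.
  rewrite expr2 mulrA ltr_pM2r //; nra.
suff : nbhs (0 : CC R) [set h | h != 0 -> cabs h < r /\ h != 0] by [].
by apply/nbhs_cabsP; exists r => // w; rewrite subr0.
Unshelve. all: by end_near.
Qed.

End Modulus.

(** * Cauchy estimates for polynomials *)

Lemma prim_root_exists (F : numClosedFieldType) n :
  (0 < n)%N -> exists w : F, n.-primitive_root w.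
Proof.
move=> n0; have [s Dp] := closed_field_poly_normal ('X^n - 1 : {poly F}).
rewrite (monicP (monicXnsubC _ n0)) scale1r in Dp.
have s1 : all n.-unity_root s.
  by apply/allP => z; rewrite -root_prod_XsubC -Dp.
have us : uniq s.
  by rewrite -separable_prod_XsubC -Dp separable_Xn_sub_1 // pnatr_eq0 -lt0n.
have sz : (n <= size s)%N.
  by have := size_prod_XsubC s id; rewrite -Dp size_XnsubC // => -[->].
by have /hasP[w _ wP] := has_prim_root n0 s1 us sz; exists w.
Qed.

Section PolynomialEstimates.
Variable R : realType.
Implicit Types (p q : {poly CC R}) (z c w : CC R) (rho s d M : R).

Lemma sum_powers_root_unity (w : CC R) N m :
  N.-primitive_root w -> \sum_(j < N) (w ^+ m) ^+ j = if (N %| m)%N then N%:R else 0.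
Proof.
move=> wP; rewrite (prim_order_dvd wP); case: eqP => [->|/eqP wm1].
  under eq_bigr do rewrite expr1n.
  by rewrite sumr_const card_ord.
apply/eqP; rewrite -(mulrI_eq0 _ (mulfI (_ : w ^+ m - 1 != 0))) ?subr_eq0 //.
by rewrite -subrX1 exprAC (prim_expr_order wP) expr1n subrr.
Qed.

(** The discrete Cauchy formula: averaging [p] against the [N]-th roots of
    unity, [N] the size of [p], isolates one coefficient. *)
Lemma coef_le_sup p rho M k : 0 < rho ->
  (forall z, cabs z <= rho -> cabs p.[z] <= M) -> cabs p`_k * rho ^+ k <= M.
Proof.
move=> rho0 pM.
have M0 : 0 <= M by apply: le_trans (pM 0 _); rewrite ?cabs_ge0 // cabs0 ltW.
have [kp|pk] := ltnP k (size p); last by rewrite nth_default // cabs0 mul0r.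
set N := size p; have N0 : (0 < N)%N by apply: leq_ltn_trans kp.
have [w wP] : exists w : CC R, N.-primitive_root w.
  exact: (@prim_root_exists R[i]).
have w1 : cabs w = 1.
  apply/eqP; rewrite -(@pexpr_eq1 _ (cabs w) N) ?cabs_ge0 //.
  by rewrite -cabsX (prim_expr_order wP) cabs1.
have key : \sum_(j < N) p.[rho%:C * w ^+ j] * w ^+ (j * (N - k)) =
    N%:R * (p`_k * rho%:C ^+ k).
  under eq_bigr => j _.
    rewrite horner_coef mulr_suml.
    under eq_bigr => i _.
      have -> : p`_i * (rho%:C * w ^+ j) ^+ i * w ^+ (j * (N - k)) =
          p`_i * rho%:C ^+ i * (w ^+ (i + (N - k))) ^+ j.
        rewrite exprMn -!exprM -!mulrA -exprD; congr (_ * (_ * _ ^+ _)).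
        by rewrite -mulnDr mulnC.
      over.
    over.
  rewrite exchange_big /=.
  under eq_bigr do rewrite -mulr_sumr (sum_powers_root_unity _ wP).
  rewrite (bigD1 (Ordinal kp)) //= big1 => [|i ik].
    by rewrite addr0 subnKC ?dvdnn 1?ltnW // mulrC.
  case: ifP; rewrite ?mulr0 // => /dvdnP[t tE].
  exfalso; move: ik; rewrite -val_eqE /= => /eqP; apply.
  have iN : (i < N)%N := ltn_ord i.
  have t1 : (t = 1)%N.
    have : (0 < t * N < 2 * N)%N.
      by rewrite -tE addn_gt0 subn_gt0 kp orbT mul2n -addnn -addSn leq_add // leq_subr.
    by case: t {tE} => [|[|t]] // /andP[_]; rewrite ltn_pmul2r.
  move: tE; rewrite t1 mul1n => /eqP; rewrite addnBA 1?ltnW // -(eqn_add2r k).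
  rewrite subnK ?(leq_trans (ltnW kp) (leq_addl _ _)) //.
  by rewrite addnC eqn_add2l => /eqP.
have : cabs (N%:R * (p`_k * rho%:C ^+ k)) <= N%:R * M.
  rewrite -key (le_trans (cabs_sum _ _ _)) //.
  apply: le_trans (_ : \sum_(j < N) M <= _); last first.
    by rewrite sumr_const card_ord mulr_natl.
  apply: ler_sum => j _; rewrite cabsM cabsX w1 expr1n mulr1 pM //.
  by rewrite cabsM cabsX w1 expr1n mulr1 cabs_real gtr0_norm.
by rewrite cabsM cabs_nat ler_pM2l ?ltr0n // cabsM cabsX cabs_real gtr0_norm.
Qed.

Lemma coef_derivn_at0 p k : p`_k = p^`(k).[0] / k`!%:R.
Proof.
rewrite horner_coef0 coef_derivn addn0 ffactnn -[p`_k *+ _]mulr_natr.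
by rewrite mulfK ?pnatr_eq0 -?lt0n ?fact_gt0.
Qed.

(** Cauchy's inequality at [z]: the disc of radius [rho - s] around [z] lies
    in the disc on which [p] is bounded, and [p^`N(k).[z]] is the coefficient
    of order [k] of [p] re-expanded at [z]. *)
Lemma nderivn_le_sup p c rho s M k z : s < rho ->
  (forall z, cabs (z - c) <= rho -> cabs p.[z] <= M) -> cabs (z - c) <= s ->
  cabs p^`N(k).[z] * (rho - s) ^+ k <= M.
Proof.
move=> srho pM zs.
pose q := \poly_(i < size p) p^`N(i).[z].
have qE w : q.[w] = p.[z + w].
  by rewrite (nderiv_taylor p (mulrC _ _)) horner_poly.
have -> : p^`N(k).[z] = q`_k.
  rewrite coef_poly; case: ltnP => // pk.
  by rewrite nderivn_poly0 ?horner0.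
apply: coef_le_sup => [|w wd]; first by rewrite subr_gt0.
rewrite qE pM // addrAC (le_trans (cabsD _ _)) //.
by rewrite (le_trans (lerD zs wd)) // subrKC.
Qed.

(** Tails of the Taylor expansion are dominated by a geometric series. *)
Lemma taylor_tail_le p d M L h : 0 < d ->
  (forall z, cabs z <= d -> cabs p.[z] <= M) -> cabs h <= d / 2 ->
  cabs (p.[h] - \sum_(k < L) p`_k * h ^+ k) <= 2 * M * (cabs h / d) ^+ L.
Proof.
move=> d0 pM hd.
have M0 : 0 <= M by apply: le_trans (pM 0 _); rewrite ?cabs_ge0 // cabs0 ltW.
have hd0 : 0 <= cabs h / d by rewrite divr_ge0 ?cabs_ge0 // ltW.
have hd1 : cabs h / d <= 2^-1 by rewrite ler_pdivrMr // mulrC.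
have -> : p.[h] = \sum_(k < L + size p) p`_k * h ^+ k.
  rewrite horner_coef -!(big_mkord xpredT (fun k => p`_k * h ^+ k)).
  rewrite (big_cat_nat (leq0n (size p)) (leq_addl L _)) /=.
  rewrite [X in _ = _ + X]big_nat_cond [X in _ = _ + X]big1 ?addr0 // => i.
  by move=> /andP[/andP[pi _] _]; rewrite nth_default ?mul0r.
rewrite big_split_ord /= addrAC subrr add0r.
have -> : 2 * M * (cabs h / d) ^+ L = M * (cabs h / d) ^+ L * 2 by ring.
apply: le_trans (cabs_sum _ _ _) _.
apply: le_trans (_ : M * (cabs h / d) ^+ L * \sum_(i < size p) (2^-1) ^+ i <= _).
  rewrite mulr_sumr; apply: ler_sum => i _.
  rewrite cabsM cabsX.
  have dL : 0 < d ^+ (L + i) by rewrite exprn_gt0.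
  rewrite (le_trans (_ : _ <= M * (cabs h / d) ^+ (L + i))) //.
    rewrite expr_div_n mulrA ler_pdivlMr // mulrAC.
    by rewrite ler_wpM2r ?exprn_ge0 ?cabs_ge0 ?coef_le_sup.
  rewrite exprD mulrA ler_wpM2l ?mulr_ge0 ?exprn_ge0 //.
  by rewrite lerXn2r ?nnegrE ?invr_ge0.
rewrite ler_wpM2l ?mulr_ge0 ?exprn_ge0 //.
elim: (size p) => [|n IH]; first by rewrite big_ord0.
rewrite big_ord_recl /= expr0.
under eq_bigr do rewrite exprS.
by rewrite -mulr_sumr; lra.
Qed.

(** The constant depends on [p] only through its bound [M], so that the
    estimate is uniform along a bounded sequence of polynomials. *)
Lemma taylor_quadratic p c rho s M z h : s < rho ->
  (forall z, cabs (z - c) <= rho -> cabs p.[z] <= M) -> cabs (z - c) <= s ->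
  cabs h <= (rho - s) / 2 ->
  cabs (p.[h + z] - p.[z] - h * p^`().[z]) <= 2 * M / (rho - s) ^+ 2 * cabs h ^+ 2.
Proof.
move=> srho pM zs hd.
pose q := \poly_(i < size p) p^`N(i).[z].
have qE w : q.[w] = p.[w + z].
  by rewrite addrC (nderiv_taylor p (mulrC _ _)) horner_poly.
have qk k : q`_k = p^`N(k).[z].
  rewrite coef_poly; case: ltnP => // pk.
  by rewrite nderivn_poly0 ?horner0.
have d0 : 0 < rho - s by rewrite subr_gt0.
have qM w : cabs w <= rho - s -> cabs q.[w] <= M.
  move=> wd; rewrite qE pM // -addrA (le_trans (cabsD _ _)) //.
  by rewrite (le_trans (lerD wd zs)) // subrK.
have := @taylor_tail_le q (rho - s) M 2 h d0 qM hd.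
rewrite !big_ord_recl big_ord0 /= !qk qE nderivn0 nderivn1 expr0 mulr1 addr0.
rewrite opprD addrA expr1 [h * _]mulrC expr_div_n.
by rewrite [_ * (_ / _)]mulrA mulrAC.
Qed.

End PolynomialEstimates.

(** * Uniform limits of polynomials on a disc *)

Section DiscAlgebra.
Variable R : realType.
Implicit Types (p q : {poly CC R}) (z c w : CC R) (rho s d M e : R).
Implicit Types (f g : CC R -> CC R).

Lemma mul_close (M M' e : R) : 0 < e -> exists2 d, 0 < d &
  forall a b a' b' : CC R, cabs a <= M -> cabs b <= M' ->
    cabs (a - a') <= d -> cabs (b - b') <= d -> cabs (a * b - a' * b') <= e.
Proof.
move=> e0; have M0 := normr_ge0 M; have M0' := normr_ge0 M'.
pose K := 1 + `|M| + `|M'|.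
have K0 : 0 < K by rewrite /K; lra.
(* The bound [1] on [d] keeps [b'] bounded by [M' + 1]. *)
pose d := Num.min 1 (e / (2 * K)).
have dK : K * d <= e / 2.
  have : d <= e / (2 * K) by rewrite ge_min lexx orbT.
  rewrite ler_pdivlMr ?mulr_gt0 // => H; rewrite ler_pdivlMr //; lra.
exists d => [|a b a' b' aM bM' aa bb].
  by rewrite lt_min ltr01 divr_gt0 ?mulr_gt0.
have -> : a * b - a' * b' = a * (b - b') + b' * (a - a') by ring.
rewrite (le_trans (cabsD _ _)) // !cabsM.
have aK : cabs a <= K by have := ler_norm M; rewrite /K; lra.
have bK : cabs b' <= K.
  rewrite (le_trans (cabs_triB _ b)) //.
  have := ler_norm M'; have : d <= 1 by rewrite ge_min lexx.
  by rewrite cabsB in bb; rewrite /K; lra.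
by rewrite (splitr e) lerD // (le_trans _ dK) // ler_pM ?cabs_ge0.
Qed.

Lemma exists_rate_lt (K e : R) : 0 < e -> exists n : nat, K / n.+1%:R < e.
Proof.
move=> e0; have K0 : 0 <= `|K| / e by rewrite divr_ge0 // ltW.
exists (Num.bound (`|K| / e)).
rewrite ltr_pdivrMr ?ltr0n // mulrC -ltr_pdivrMr //.
apply: le_lt_trans (_ : `|K| / e < _).
  by rewrite ler_pM2r ?invr_gt0 // ler_norm.
by apply: lt_le_trans (archi_boundP K0) _; rewrite ler_nat.
Qed.

Lemma le_of_rate (x y K : R) : (forall n, x <= y + K / n.+1%:R) -> x <= y.
Proof.
move=> H; apply/ler_addgt0Pr => e e0; have [n ne] := exists_rate_lt K e0.
by rewrite (le_trans (H n)) // lerD2l ltW.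
Qed.

(** The disc algebra: continuous functions on the closed disc that are
    holomorphic inside. Defined by polynomial approximation, it is visibly
    closed under the ring operations and uniform limits, and it inherits the
    Cauchy estimates of polynomials without any contour integral. *)
Definition disc_algebra c rho f := forall e, 0 < e ->
  exists p, forall z, cabs (z - c) <= rho -> cabs (f z - p.[z]) <= e.

Lemma disc_algebra_poly c rho p : disc_algebra c rho (horner p).
Proof. by move=> e e0; exists p => z _; rewrite subrr cabs0 ltW. Qed.

Lemma disc_algebra_limit c rho f :
  (forall e, 0 < e -> exists2 g, disc_algebra c rho g &
     forall z, cabs (z - c) <= rho -> cabs (f z - g z) <= e) ->
  disc_algebra c rho f.
Proof.
move=> H e e0; have e2 : 0 < e / 2 by rewrite divr_gt0.
have [g gP fg] := H _ e2; have [p gp] := gP _ e2.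
exists p => z zc; rewrite (le_trans (cabs_tri _ (g z) _)) //.
by rewrite (le_trans (lerD (fg _ zc) (gp _ zc))) // -splitr.
Qed.

Lemma disc_algebra_ext c rho f g :
  (forall z, cabs (z - c) <= rho -> f z = g z) ->
  disc_algebra c rho f -> disc_algebra c rho g.
Proof.
move=> fg fP; apply: disc_algebra_limit => e e0; exists f => // z zc.
by rewrite fg // subrr cabs0 ltW.
Qed.

Lemma disc_algebra_const c rho w : disc_algebra c rho (fun=> w).
Proof.
apply: disc_algebra_ext (disc_algebra_poly c rho w%:P) => z _.
by rewrite hornerC.
Qed.

Lemma disc_algebra_bounded c rho f : disc_algebra c rho f ->
  exists M, forall z, cabs (z - c) <= rho -> cabs (f z) <= M.
Proof.
move=> /(_ 1 ltr01)[p fp].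
exists (\sum_(i < size p) cabs p`_i * (`|rho| + cabs c) ^+ i + 1) => z zc.
rewrite (le_trans (cabs_triB _ p.[z])) // lerD ?fp //.
rewrite horner_coef (le_trans (cabs_sum _ _ _)) // ler_sum // => i _.
rewrite cabsM cabsX ler_wpM2l ?cabs_ge0 // lerXn2r ?nnegrE ?addr_ge0 ?cabs_ge0 //.
rewrite (le_trans (cabs_triB z c)) // addrC lerD2r (le_trans zc) //.
exact: ler_norm.
Qed.

Lemma disc_algebraD c rho f g : disc_algebra c rho f -> disc_algebra c rho g ->
  disc_algebra c rho (fun z => f z + g z).
Proof.
move=> fP gP e e0; have e2 : 0 < e / 2 by rewrite divr_gt0.
have [p fp] := fP _ e2; have [q gq] := gP _ e2.
exists (p + q) => z zc; rewrite hornerD opprD addrACA.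
by rewrite (le_trans (cabsD _ _)) // (splitr e) lerD ?fp ?gq.
Qed.

Lemma disc_algebraM c rho f g : disc_algebra c rho f -> disc_algebra c rho g ->
  disc_algebra c rho (fun z => f z * g z).
Proof.
move=> fP gP e e0.
have [M fM] := disc_algebra_bounded fP; have [M' gM'] := disc_algebra_bounded gP.
have [d d0 dP] := mul_close M M' e0.
have [p fp] := fP _ d0; have [q gq] := gP _ d0.
exists (p * q) => z zc; rewrite hornerM.
by apply: dP; [exact: fM|exact: gM'|exact: fp|exact: gq].
Qed.

Lemma disc_algebraB c rho f g : disc_algebra c rho f -> disc_algebra c rho g ->
  disc_algebra c rho (fun z => f z - g z).
Proof.
move=> fP gP; have := disc_algebraD fP (disc_algebraM (disc_algebra_const c rho (-1)) gP).
by apply: disc_algebra_ext => z _; rewrite mulN1r.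
Qed.

(** Polynomials uniformly close to [f] have, by the Cauchy estimates, close
    derivatives on a smaller disc; their limit is the derivative of [f]
    because the quadratic Taylor bound is uniform along the approximation. *)
Lemma disc_algebra_derive c rho s f : s < rho -> disc_algebra c rho f ->
  [/\ forall z, cabs (z - c) <= s -> derivable f z 1,
      disc_algebra c s (derive1 f) &
      forall p e, (forall z, cabs (z - c) <= rho -> cabs (f z - p.[z]) <= e) ->
        forall z, cabs (z - c) <= s ->
          cabs (derive1 f z - p^`().[z]) <= e / (rho - s)].
Proof.
move=> srho fP; have d0 : 0 < rho - s by rewrite subr_gt0.
have cauchy p q e : (forall z, cabs (z - c) <= rho -> cabs (p.[z] - q.[z]) <= e) ->
    forall z, cabs (z - c) <= s -> cabs (p^`().[z] - q^`().[z]) <= e / (rho - s).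
  move=> pq z zs; rewrite ler_pdivlMr // -hornerN -hornerD -derivB.
  have := @nderivn_le_sup R (p - q) c rho s e 1 z srho _ zs.
  rewrite nderivn1 expr1; apply => w wc.
  by rewrite hornerD hornerN pq.
have eps0 n : 0 < n.+1%:R^-1 :> R by rewrite invr_gt0 ltr0n.
have /choice[P PP] : forall n, exists p, forall z, cabs (z - c) <= rho ->
    cabs (f z - p.[z]) <= n.+1%:R^-1 by move=> n; exact: fP.
have main z : cabs (z - c) <= s -> derivable f z 1 /\
    forall p e, (forall z, cabs (z - c) <= rho -> cabs (f z - p.[z]) <= e) ->
      cabs (derive1 f z - p^`().[z]) <= e / (rho - s).
  move=> zs.
  have [l lP] : exists l, forall n,
      cabs ((P n)^`().[z] - l) <= 2 / (rho - s) / n.+1%:R.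
    apply: cauchy_rate => n m nm.
    rewrite mulrAC.
    apply: cauchy zs => w wc.
    rewrite (le_trans (cabs_tri _ (f w) _)) //.
    have := PP n w wc; have := PP m w wc; rewrite cabsB => h1 h2.
    rewrite (le_trans (lerD h1 h2)) // mulr2n mulrDl mul1r lerD2r.
    by rewrite lef_pV2 ?posrE ?ltr0n // ler_nat ltnS.
  have [M fM] := disc_algebra_bounded fP.
  have [|fd fl] := @derive1_quadratic R f z l ((rho - s) / 2)
      (2 * (M + 1) / (rho - s) ^+ 2) (divr_gt0 d0 (ltr0n R 2)).
    move=> h hd.
    have inner w : cabs (w - z) <= rho - s -> cabs (w - c) <= rho.
      move=> wz; rewrite (le_trans (cabs_tri _ z _)) //.
      by rewrite (le_trans (lerD wz zs)) // subrK.
    have hz : cabs (h + z - c) <= rho by apply: inner; rewrite addrK; lra.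
    have z0 : cabs (z - c) <= rho by apply: inner; rewrite subrr cabs0 ltW.
    apply: (@le_of_rate _ _ (2 + cabs h * (2 / (rho - s)))) => n.
    have PM w : cabs (w - c) <= rho -> cabs (P n).[w] <= M + 1.
      move=> wc; rewrite (le_trans (cabs_triB _ (f w))) // lerD ?fM //.
      rewrite cabsB (le_trans (PP _ _ wc)) // invf_le1 ?ltr0n //.
      by rewrite ler1n.
    have quad := taylor_quadratic srho PM zs hd.
    rewrite (le_trans (cabs_triB _ ((P n).[h + z] - (P n).[z] - h * (P n)^`().[z]))) //.
    rewrite lerD //.
    have -> : f (h + z) - f z - h * l - ((P n).[h + z] - (P n).[z] - h * (P n)^`().[z])
        = (f (h + z) - (P n).[h + z]) - (f z - (P n).[z]) + h * ((P n)^`().[z] - l).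
      by ring.
    rewrite (le_trans (cabsD _ _)) // mulrDl lerD //.
      rewrite (le_trans (cabsD _ _)) // cabsN mulr2n mulrDl mul1r.
      by rewrite lerD ?PP.
    by rewrite cabsM -mulrA ler_wpM2l ?cabs_ge0.
  split => // p e fp.
  rewrite fl.
  apply: (@le_of_rate _ _ (1 / (rho - s) + 2 / (rho - s))) => n.
  rewrite (le_trans (cabs_tri _ (P n)^`().[z] _)) //.
  have h1 := lP n; rewrite cabsB in h1.
  have h2 : cabs ((P n)^`().[z] - p^`().[z]) <= (n.+1%:R^-1 + e) / (rho - s).
    apply: cauchy zs => w wc.
    rewrite (le_trans (cabs_tri _ (f w) _)) // lerD ?fp // cabsB; exact: PP.
  rewrite (le_trans (lerD h1 h2)) //.
  by rewrite le_eqVlt; apply/orP; left; apply/eqP; ring.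
split.
- by move=> z /main[].
- move=> e e0; have [p fp] := fP _ (mulr_gt0 e0 d0).
  exists p^`() => z zs; have [_ /(_ _ _ fp)] := main z zs.
  by rewrite mulfK ?gt_eqF.
- by move=> p e fp z zs; have [_] := main z zs; apply.
Qed.

Lemma disc_algebraS c rho s f : s <= rho -> disc_algebra c rho f ->
  disc_algebra c s f.
Proof.
move=> srho fP e /fP[p fp]; exists p => z zs; apply: fp.
exact: le_trans srho.
Qed.

(** Iterated Cauchy estimate. Comparing with a polynomial [p], instead of
    bounding the derivatives of [f] alone, also identifies them. *)
Lemma disc_algebra_derive1n k c rho s : s < rho ->
  exists2 C, 0 <= C & forall f, disc_algebra c rho f ->
  [/\ disc_algebra c s (derive1n k f),
      forall z, cabs (z - c) <= s -> derivable (derive1n k f) z 1 &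
      forall p e, (forall z, cabs (z - c) <= rho -> cabs (f z - p.[z]) <= e) ->
        forall z, cabs (z - c) <= s ->
          cabs (derive1n k f z - p^`(k).[z]) <= C * e].
Proof.
elim: k rho => [|k IH] rho srho.
  exists 1 => // f fP; have [fd _ _] := disc_algebra_derive srho fP.
  split => [|//|p e fp z zs].
    exact: disc_algebraS (ltW srho) fP.
  by rewrite mul1r fp // (le_trans zs) // ltW.
(* One differentiation costs the passage to the intermediate radius [t]. *)
pose t := (s + rho) / 2.
have st : s < t by rewrite /t; lra.
have tr : t < rho by rewrite /t; lra.
have [C C0 CP] := IH t st.
exists (C / (rho - t)) => [|f fP].
  by rewrite divr_ge0 // subr_ge0 ltW.
have [_ f'P f'p] := disc_algebra_derive tr fP.
have [] := CP _ f'P; rewrite -!derive1Sn => h1 h2 h3; split => //.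
move=> p e fp z zs; rewrite derivSn mulrAC -mulrA.
by apply: h3 zs => w wt; apply: f'p.
Qed.

End DiscAlgebra.

(** * The complex exponential *)

Section ComplexExp.
Variable R : realType.
Implicit Types (p q : {poly CC R}) (z c w : CC R) (rho s d M e : R).
Implicit Types (f g : CC R -> CC R).

(** The polynomial bound [taylor_tail_le] passes to the uniform limit because
    each Taylor coefficient is continuous in the uniform norm. The factor
    [cabs h ^+ L] leaves room for dividing the remainder by [h]. *)
Lemma disc_algebra_taylor rho M L f h : 0 < rho -> disc_algebra 0 rho f ->
  (forall z, cabs z <= rho -> cabs (f z) <= M) -> cabs h <= rho / 2 ->
  cabs (f h - \sum_(k < L) derive1n k f 0 / k`!%:R * h ^+ k)
    <= 2 * M * (cabs h / rho) ^+ L.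
Proof.
move=> rho0 fP fM hr.
have /choice[C CP] : forall k, exists C, forall p e,
    (forall z, cabs (z - 0) <= rho -> cabs (f z - p.[z]) <= e) ->
    cabs (derive1n k f 0 - p^`(k).[0]) <= C * e.
  move=> k; have [C _ /(_ f fP)[_ _ H]] := @disc_algebra_derive1n R k 0 rho 0 rho0.
  by exists C => p e /H; apply; rewrite subrr cabs0.
have eps0 n : 0 < n.+1%:R^-1 :> R by rewrite invr_gt0 ltr0n.
pose K := 1 + 2 * (cabs h / rho) ^+ L + \sum_(k < L) C k * cabs h ^+ k.
apply: (@le_of_rate R _ _ K) => n.
have [p fp] := fP _ (eps0 n).
have fp0 w : cabs w <= rho -> cabs (f w - p.[w]) <= n.+1%:R^-1.
  by move=> wr; apply: fp; rewrite subr0.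
have pM w : cabs w <= rho -> cabs p.[w] <= M + n.+1%:R^-1.
  by move=> wr; rewrite (le_trans (cabs_triB _ (f w))) // lerD ?fM // cabsB fp0.
have tail := taylor_tail_le L rho0 pM hr.
have hr' : cabs h <= rho by lra.
have coefs : cabs (\sum_(k < L) derive1n k f 0 / k`!%:R * h ^+ k
    - \sum_(k < L) p`_k * h ^+ k) <= (\sum_(k < L) C k * cabs h ^+ k) / n.+1%:R.
  rewrite -sumrB mulr_suml (le_trans (cabs_sum _ _ _)) // ler_sum // => k _.
  rewrite -mulrBl coef_derivn_at0 -mulrBl !cabsM cabsX [leRHS]mulrAC.
  rewrite ler_wpM2r ?exprn_ge0 ?cabs_ge0 //.
  rewrite cabsV cabs_nat ler_pdivrMr ?ltr0n ?fact_gt0 //.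
  have H := CP k _ _ fp; rewrite (le_trans H) // ler_peMr ?ler1n ?fact_gt0 //.
  by rewrite (le_trans _ H) ?cabs_ge0.
rewrite (le_trans (cabs_tri _ p.[h] _)) //.
have := cabs_tri p.[h] (\sum_(k < L) p`_k * h ^+ k)
  (\sum_(k < L) derive1n k f 0 / k`!%:R * h ^+ k).
move=> /(lerD (fp0 _ hr'))/le_trans; apply.
rewrite [cabs (\sum_(_ < _) _ - _)]cabsB.
apply: le_trans (lerD (lexx _) (lerD tail coefs)) _.
by rewrite /K le_eqVlt; apply/orP; left; apply/eqP; ring.
Qed.

Lemma cexpD z w : cexp (z + w) = cexp z * cexp w.
Proof.
case: z w => [a b] [x y] /=; rewrite expRD cosD sinD.
by apply/eqP; rewrite eq_complex /=; apply/andP; split; apply/eqP; ring.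
Qed.

Lemma cexp0 : cexp 0 = 1 :> CC R.
Proof. by rewrite /= expR0 cos0 sin0 mulr1 mulr0. Qed.

Lemma cexpK z : cexp z * cexp (- z) = 1.
Proof. by rewrite -cexpD subrr cexp0. Qed.

Lemma cexp_neq0 z : cexp z != 0.
Proof.
by apply/eqP => z0; have := cexpK z; rewrite z0 mul0r => /esym/eqP; rewrite oner_eq0.
Qed.

Lemma cexpN z : cexp (- z) = (cexp z)^-1.
Proof. by apply: (mulfI (cexp_neq0 z)); rewrite cexpK divff ?cexp_neq0. Qed.

Lemma cexpMn z n : cexp (n%:R * z) = cexp z ^+ n.
Proof.
elim: n => [|n IH]; first by rewrite mul0r cexp0.
by rewrite -natr1 mulrDl mul1r cexpD IH exprSr.
Qed.

Lemma cabs_cexp z : cabs (cexp z) = expR (complex.Re z).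
Proof.
case: z => x y; rewrite cabs_normc /= !exprMn -mulrDr cos2Dsin2 mulr1.
by rewrite sqrtr_sqr ger0_norm ?expR_ge0.
Qed.

Lemma cabs_cexp_le z : cabs (cexp z) <= expR (cabs z).
Proof.
by rewrite cabs_cexp ler_expR (le_trans (ler_norm _)) ?cabs_Re.
Qed.

Lemma abs_sin_le (y : R) : `|sin y| <= `|y|.
Proof.
have H (x : R) : 0 < x -> `|sin x| <= `|x|.
  move=> x0.
  have [|t _] := MVT x0 (fun y _ => is_derive_sin y).
    by apply: continuous_subspaceT => ?; exact: continuous_sin.
  rewrite sin0 !subr0 => ->; rewrite normrM ler_piMl //.
  exact: cos_max.
have [y0|y0|->] := ltgtP y 0; [|exact: H|by rewrite sin0].
by have := H (- y); rewrite sinN !normrN oppr_gt0; apply.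
Qed.

Lemma abs_cos_sub1_le (y : R) : `|cos y - 1| <= y ^+ 2.
Proof.
have -> : cos y - 1 = - 2 * sin (y / 2) ^+ 2.
  have := cosD (y / 2) (y / 2); rewrite -splitr -!expr2 => ->.
  have := cos2Dsin2 (y / 2); lra.
rewrite normrM normrX normrN normr_nat.
have := abs_sin_le (y / 2); rewrite normrM normfV normr_nat => H.
have : `|sin (y / 2)| ^+ 2 <= (`|y| / 2) ^+ 2.
  by rewrite lerXn2r ?nnegrE ?divr_ge0.
rewrite expr_div_n !real_normK ?num_real // => H2.
have := sqr_ge0 y; lra.
Qed.

Lemma abs_sin_subid_le (y : R) : `|y| <= 1 -> `|sin y - y| <= y ^+ 2.
Proof.
have H (x : R) : 0 < x -> x <= 1 -> `|sin x - x| <= x ^+ 2.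
  move=> x0 x1.
  have d (t : R) : t \in `]0, x[ -> is_derive t 1 (fun u => sin u - u) (cos t - 1).
    by move=> _; apply: is_deriveB.
  have [|t] := MVT x0 d.
    apply: continuous_subspaceT => t.
    by apply: continuousB; [exact: continuous_sin|exact: cvg_id].
  rewrite in_itv /= => /andP[t0 tx].
  rewrite sin0 !subr0 => ->; rewrite normrM [`|x|]gtr0_norm // expr2 ler_pM2r //.
  rewrite (le_trans (abs_cos_sub1_le _)) // expr2; nra.
move=> y1; have [y0|y0|->] := ltgtP y 0; last by rewrite sin0 subrr normr0 sqr_ge0.
- have := H (- y); rewrite sinN -opprD normrN sqrrN oppr_gt0; apply=> //.
  by move: y1; rewrite ltr0_norm.
- by apply: H => //; move: y1; rewrite gtr0_norm.
Qed.

Lemma abs_expR_sub_le (x : R) : `|x| <= 2^-1 -> `|expR x - 1 - x| <= 2 * x ^+ 2.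
Proof.
rewrite ler_norml => /andP[x1 x2].
have h1 := expR_ge1Dx x.
have h2 : expR x * (1 - x) <= 1.
  have := expR_ge1Dx (- x); rewrite expRN => H.
  by rewrite -ler_pdivlMl ?expR_gt0 // mulr1.
have h3 := expR_gt0 x.
rewrite ger0_norm; last lra.
have xx := sqr_ge0 x; rewrite expr2 in xx *.
nra.
Qed.

Lemma cexp_quadratic w : cabs w <= 2^-1 ->
  cabs (cexp w - 1 - w) <= 16 * cabs w ^+ 2.
Proof.
move: (cabs_ge0 w) (cabs_Re w) (cabs_Im w); move: (cabs w) => r.
case: w => x y /= r0 rx ry w1.
have hx := le_trans rx w1; have hy := le_trans ry w1.
apply: le_trans (cabs_ReIm _) _ => /=.
have xr : x ^+ 2 <= r ^+ 2.
  by rewrite -(real_normK (num_real x)) lerXn2r ?nnegrE.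
have yr : y ^+ 2 <= r ^+ 2.
  by rewrite -(real_normK (num_real y)) lerXn2r ?nnegrE.
have e0 := expR_gt0 x.
have ex := abs_expR_sub_le hx.
have e2 : expR x <= 2.
  have := ler_norm (expR x - 1 - x); move: hx; rewrite ler_norml => /andP[? ?].
  have : x ^+ 2 <= 4^-1 by rewrite expr2; nra.
  lra.
have cy := abs_cos_sub1_le y.
have sy : `|sin y - y| <= y ^+ 2 by apply: abs_sin_subid_le; lra.
have e1 : `|expR x - 1| <= 2 * r.
  have -> : expR x - 1 = (expR x - 1 - x) + x by ring.
  rewrite (le_trans (ler_normD _ _)) //.
  have : r ^+ 2 <= 2^-1 * r by rewrite expr2; nra.
  lra.
have re : `|expR x * cos y - 1 - x| <= 4 * r ^+ 2.
  have -> : expR x * cos y - 1 - x = expR x * (cos y - 1) + (expR x - 1 - x) by ring.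
  rewrite (le_trans (ler_normD _ _)) // normrM (gtr0_norm e0).
  have : expR x * `|cos y - 1| <= 2 * y ^+ 2 by rewrite ler_pM // ltW.
  lra.
have im : `|expR x * sin y - y| <= 4 * r ^+ 2.
  have -> : expR x * sin y - y = expR x * (sin y - y) + (expR x - 1) * y by ring.
  rewrite (le_trans (ler_normD _ _)) // !normrM (gtr0_norm e0).
  have : expR x * `|sin y - y| <= 2 * y ^+ 2 by rewrite ler_pM // ltW.
  have : `|expR x - 1| * `|y| <= 2 * r * r by rewrite ler_pM.
  rewrite expr2 in yr *; lra.
rewrite !subr0; have := sqr_ge0 r; lra.
Qed.

Lemma cabs_sub_expn_le (a b : CC R) (K : R) N : 1 <= K ->
  cabs a <= K -> cabs b <= K -> cabs (a ^+ N - b ^+ N) <= N%:R * cabs (a - b) * K ^+ N.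
Proof.
move=> K1 aK bK; have K0 : 0 <= K by lra.
rewrite subrXX cabsM -mulrA mulrCA ler_wpM2l ?cabs_ge0 //.
rewrite (le_trans (cabs_sum _ _ _)) //.
apply: le_trans (_ : \sum_(i < N) K ^+ N <= _).
  apply: ler_sum => i _; rewrite cabsM !cabsX.
  apply: le_trans (_ : K ^+ (N.-1 - i) * K ^+ i <= _).
    by rewrite ler_pM ?exprn_ge0 ?cabs_ge0 // lerXn2r ?nnegrE ?cabs_ge0.
  have iN := ltn_ord i.
  by rewrite -exprD ler_weXn2l // subnK ?leq_pred // -ltnS prednK // (leq_ltn_trans _ iN).
by rewrite sumr_const card_ord mulr_natl.
Qed.

(** [cexp] is the locally uniform limit of the polynomials [(1 + w / N) ^ N]:
    the two factors [cexp (w / N)] and [1 + w / N] differ by [O (1 / N ^ 2)]. *)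
Lemma cexp_pow_rate rho N z : (0 < N)%N -> 0 <= rho -> rho / N%:R <= 2^-1 ->
  cabs z <= rho ->
  cabs (cexp z - (1 + z / N%:R) ^+ N) <= 16 * rho ^+ 2 * expR rho / N%:R.
Proof.
move=> N0 rho0 wh zr.
have NR : 0 < N%:R :> R by rewrite ltr0n.
have NC : N%:R != 0 :> CC R by rewrite pnatr_eq0 -lt0n.
have {1}-> : z = N%:R * (z / N%:R) by rewrite mulrC divfK.
rewrite cexpMn; set w := z / _.
have wr : cabs w <= rho / N%:R.
  by rewrite cabsM cabsV cabs_nat ler_pM2r ?invr_gt0.
have rN0 : 0 <= rho / N%:R by rewrite divr_ge0 // ltW.
have E0 := expR_gt0 rho.
apply: le_trans (@cabs_sub_expn_le _ _ (expR (rho / N%:R)) _ _ _ _) _.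
- by rewrite -[leLHS]expR0 ler_expR.
- by rewrite (le_trans (cabs_cexp_le _)) // ler_expR.
- rewrite (le_trans (cabsD _ _)) // cabs1 (le_trans _ (expR_ge1Dx _)) // lerD2l //.
rewrite -expRM_natl mulrC -[rho / _]mulrC mulVKf ?gt_eqF //.
have q : cabs (cexp w - (1 + w)) <= 16 * (rho / N%:R) ^+ 2.
  rewrite opprD addrA (le_trans (cexp_quadratic (le_trans wr wh))) //.
  by rewrite ler_wpM2l // lerXn2r ?nnegrE ?cabs_ge0.
apply: le_trans (_ : expR rho * (N%:R * (16 * (rho / N%:R) ^+ 2)) <= _).
  by rewrite ler_pM2l // ler_pM2l.
have -> : expR rho * (N%:R * (16 * (rho / N%:R) ^+ 2)) =
    16 * rho ^+ 2 * expR rho * (N%:R / N%:R) / N%:R by ring.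
by rewrite divff ?gt_eqF // mulr1.
Qed.

Lemma disc_algebra_cexp rho : 0 < rho -> disc_algebra 0 rho (@cexp R).
Proof.
move=> rho0 e e0.
(* The second summand forces [rho / N <= 1/2]. *)
pose K := 16 * rho ^+ 2 * expR rho + e * (2 * rho).
have [n ne] := exists_rate_lt K e0.
exists ((1 + (n.+1%:R)^-1 *: 'X) ^+ n.+1) => z; rewrite subr0 => zr.
rewrite horner_exp hornerD hornerZ hornerX hornerC mulrC.
have N0 : 0 < n.+1%:R :> R by rewrite ltr0n.
have ne' : K < e * n.+1%:R by rewrite -ltr_pdivrMr.
have E0 := expR_gt0 rho.
have wh : rho / n.+1%:R <= 2^-1.
  rewrite ler_pdivrMr // ler_pdivlMl //.
  have : e * (2 * rho) <= K by rewrite lerDr !mulr_ge0 // ?sqr_ge0 // ltW.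
  move=> /le_lt_trans/(_ ne'); rewrite ltr_pM2l // => /ltW; lra.
rewrite (le_trans (cexp_pow_rate _ (ltW rho0) wh zr)) //.
rewrite ler_pdivrMr // (le_trans _ (ltW ne')) // lerDl.
by rewrite !mulr_ge0 // ltW.
Qed.

Lemma derive1_cexp : derive1 (@cexp R) = @cexp R.
Proof.
apply/funext => z.
have h0 : 0 < 2^-1 :> R by rewrite invr_gt0.
have [|_ ->] // := @derive1_quadratic R (@cexp R) z (cexp z) 2^-1 (cabs (cexp z) * 16) h0.
move=> h h1.
have -> : cexp (h + z) - cexp z - h * cexp z = cexp z * (cexp h - 1 - h).
  by rewrite cexpD; ring.
by rewrite cabsM -mulrA ler_wpM2l ?cabs_ge0 ?cexp_quadratic.
Qed.

Lemma derive1n_cexp k : derive1n k (@cexp R) = @cexp R.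
Proof. by elim: k => [//|k IH]; rewrite derive1nS IH derive1_cexp. Qed.

(** All derivatives of [cexp] at [0] are [1], so its Taylor sums are those of
    the exponential series; [expR 2] bounds [cexp] on the disc of radius [2]. *)
Lemma cexp_taylor L w : cabs w <= 1 ->
  cabs (cexp w - \sum_(k < L) w ^+ k / k`!%:R) <= 2 * expR 2 * (cabs w / 2) ^+ L.
Proof.
move=> w1.
have eM z : cabs z <= 2 -> cabs (cexp z) <= expR 2 :> R.
  by move=> z2; rewrite (le_trans (cabs_cexp_le _)) // ler_expR.
have := @disc_algebra_taylor 2 (expR 2) L (@cexp R) w (ltr0n _ 2)
  (disc_algebra_cexp (ltr0n _ 2)) eM.
rewrite divff ?pnatr_eq0 // => /(_ w1).
under eq_bigr do rewrite derive1n_cexp cexp0 mul1r mulrC.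
by [].
Qed.

End ComplexExp.

(** * Infinite products with quadratically small terms *)

Section Products.
Variable R : realType.
Implicit Types (z u w : CC R) (A : R).

Lemma inv_sub (x y : R) : x != 0 -> y != 0 -> x^-1 - y^-1 = (y - x) / (x * y).
Proof. by move=> x0 y0; field; rewrite x0 y0. Qed.

(** [A / q ^ 2] is dominated by the telescoping difference
    [2 * A / q - 2 * A / (q + 1)], which makes every estimate explicit. *)
Lemma inv_sqr_telescope A n : 0 <= A ->
  A / n.+1%:R ^+ 2 <= 2 * A / n.+1%:R - 2 * A / n.+2%:R.
Proof.
move=> A0.
have -> : 2 * A / n.+1%:R - 2 * A / n.+2%:R = A * (2 / (n.+1%:R * n.+2%:R)).
  have n1 : n.+1%:R != 0 :> R by rewrite pnatr_eq0.
  have n2 : n.+2%:R != 0 :> R by rewrite pnatr_eq0.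
  by rewrite -mulrBr inv_sub // -natrB // subSnn; ring.
rewrite ler_wpM2l // -[leLHS]mul1r ler_pdivrMr ?exprn_gt0 ?ltr0n //.
rewrite mulrAC ler_pdivlMr ?mulr_gt0 ?ltr0n // mul1r expr2.
rewrite -!natrM ler_nat mulnA [(2 * _)%N]mulnC -mulnA leq_mul2l /=.
by rewrite !mul2n -addnn addSn ltnS addnS ltnS leq_addr.
Qed.

Lemma prod_le_expR (a : nat -> CC R) A n : 0 <= A ->
  (forall q, (0 < q)%N -> cabs (a q) <= A / q%:R ^+ 2) ->
  cabs (\prod_(1 <= q < n.+1) (1 + a q)) <= expR (2 * A).
Proof.
move=> A0 aA.
apply: le_trans (_ : expR (2 * A - 2 * A / n.+1%:R) <= _); last first.
  by rewrite ler_expR gerBl divr_ge0 ?mulr_ge0.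
elim: n => [|n IH]; first by rewrite big_geq // cabs1 divr1 subrr expR0.
rewrite big_nat_recr //= cabsM.
have -> : 2 * A - 2 * A / n.+2%:R =
  (2 * A - 2 * A / n.+1%:R) + (2 * A / n.+1%:R - 2 * A / n.+2%:R) by ring.
rewrite expRD ler_pM ?cabs_ge0 //.
rewrite (le_trans (cabsD _ _)) // cabs1 (le_trans _ (expR_ge1Dx _)) // lerD2l.
by rewrite (le_trans (aA _ _)) // inv_sqr_telescope.
Qed.

(** Successive partial products differ by at most [A / q ^ 2] times their
    common bound, hence the [1 / n] rate of convergence. *)
Lemma prod_cvg_rate (a : nat -> CC R) A : 0 <= A ->
  (forall q, (0 < q)%N -> cabs (a q) <= A / q%:R ^+ 2) ->
  forall n, cabs (\prod_(1 <= q < n.+1) (1 + a q) -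
     lim ((fun N => \prod_(1 <= q < N.+1) (1 + a q)) @ \oo))
     <= 2 * A * expR (2 * A) / n.+1%:R.
Proof.
move=> A0 aA; pose P n := \prod_(1 <= q < n.+1) (1 + a q).
have E0 : 0 <= expR (2 * A) by apply: expR_ge0.
have [|l lP] := @cauchy_rate R P (2 * A * expR (2 * A)).
  move=> n m nm.
  apply: le_trans (_ : expR (2 * A) * (2 * A / n.+1%:R - 2 * A / m.+1%:R) <= _).
    rewrite -(subnKC nm); elim: (m - n)%N => [|k IH].
      by rewrite addn0 !subrr cabs0 mulr0.
    rewrite addnS (le_trans (cabs_tri _ (P (n + k)%N) _)) //.
    have -> : 2 * A / n.+1%:R - 2 * A / (n + k).+2%:R =
      (2 * A / (n + k).+1%:R - 2 * A / (n + k).+2%:R) +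
      (2 * A / n.+1%:R - 2 * A / (n + k).+1%:R) by ring.
    rewrite mulrDr lerD // /P big_nat_recr //= mulrDr mulr1 addrAC subrr add0r.
    rewrite cabsM ler_pM ?cabs_ge0 ?prod_le_expR //.
    by rewrite (le_trans (aA _ _)) // inv_sqr_telescope.
  have -> : 2 * A * expR (2 * A) / n.+1%:R = expR (2 * A) * (2 * A / n.+1%:R) by ring.
  rewrite mulrBr gerBl.
  by rewrite mulr_ge0 // divr_ge0 // mulr_ge0.
have -> : lim (P @ \oo) = l; last exact: lP.
by apply: cvg_lim; [exact: norm_hausdorff|exact: cvg_rate lP].
Qed.

Definition exp_const : R := 16 + 4 * (expR 4 + 5).

Lemma exp_const_gt0 : 0 < exp_const.
Proof. by rewrite /exp_const; have := expR_gt0 (4 : R); lra. Qed.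

(** On the annulus between [1/2] and [4] the left-hand side is bounded and
    [cabs w ^+ 2] is at least [1/4]; a wide disc avoids treating small indices
    [q] separately below. *)
Lemma cexp_quadratic4 w : cabs w <= 4 -> cabs (cexp w - 1 - w) <= exp_const * cabs w ^+ 2.
Proof.
move=> w4; have e4 := expR_gt0 (4 : R); have w0 := sqr_ge0 (cabs w).
have [w1|w1] := lerP (cabs w) 2^-1.
  by rewrite (le_trans (cexp_quadratic w1)) // ler_wpM2r // /exp_const; lra.
apply: le_trans (_ : expR 4 + 5 <= _).
  rewrite (le_trans (cabsD _ _)) // cabsN.
  have : cabs (cexp w - 1) <= expR 4 + 1.
    rewrite (le_trans (cabsD _ _)) // cabsN cabs1 lerD2r.
    by rewrite (le_trans (cabs_cexp_le _)) // ler_expR.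
  lra.
have : 4^-1 <= cabs w ^+ 2 by rewrite expr2; nra.
by rewrite /exp_const; nra.
Qed.

Section Disc.
Variable z : CC R.
Hypothesis z1 : cabs (z - 1) <= 2^-1.

Lemma disc_cabs : cabs z <= 2.
Proof. have := cabs_triB z 1; rewrite cabs1; have h := z1; lra. Qed.

Lemma disc_Re : 2^-1 <= complex.Re z.
Proof.
have := le_trans (cabs_Re _) z1; rewrite ler_norml => /andP[+ _].
by case: (z) => a b /=; lra.
Qed.

(** The real part of [1 + z / q] is at least [1], since [z] lies in the right
    half-plane. *)
Lemma disc_denom q : 1 <= cabs (1 + z / q%:R).
Proof.
apply: le_trans (cabs_Re _); apply: le_trans (ler_norm _).
have -> : complex.Re (1 + z / q%:R) = 1 + complex.Re z / q%:R.
  rewrite -(rmorph_nat (real_complex R)) -fmorphV /=; case: (z) => a b /=.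
  by rewrite mulr0 subr0.
by rewrite lerDl divr_ge0 // (le_trans _ disc_Re) // invr_ge0.
Qed.

Lemma disc_denom_neq0 q : 1 + z / q%:R != 0.
Proof. by rewrite -cabs_gt0 (lt_le_trans _ (disc_denom q)). Qed.

Lemma phi_sub_inv_le u q : (0 < q)%N -> cabs u <= 1 ->
  cabs (phi q u - q%:R^-1) <= exp_const / q%:R ^+ 2.
Proof.
move=> q0 u1; have K0 := exp_const_gt0.
have qR : 0 < q%:R :> R by rewrite ltr0n.
have q1 : 1 <= q%:R :> R by rewrite ler1n.
rewrite /phi; case: eqP => [_|/eqP u0].
  by rewrite subrr cabs0 divr_ge0 ?sqr_ge0 // ltW.
have -> : (cexp (u / q%:R) - 1) / u - q%:R^-1 = (cexp (u / q%:R) - 1 - u / q%:R) / u.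
  by rewrite [RHS]mulrBl [u / q%:R]mulrC mulfK.
have up : 0 < cabs u by rewrite cabs_gt0.
rewrite cabsM cabsV ler_pdivrMr //.
have uq : cabs (u / q%:R) = cabs u / q%:R by rewrite cabsM cabsV cabs_nat.
apply: le_trans (cexp_quadratic4 _) _; rewrite uq.
  rewrite ler_pdivrMr //; lra.
rewrite expr_div_n.
have -> : exp_const / q%:R ^+ 2 * cabs u = exp_const * (cabs u / q%:R ^+ 2) by ring.
rewrite ler_pM2l // ler_pM2r ?invr_gt0 ?exprn_gt0 //.
by rewrite expr2 ler_piMl // ltW.
Qed.

(** The factors of [Rprod] are normalised so that the terms of order [1 / q]
    cancel: what remains is [z (phi_q (u) - 1 / q) / (1 + z / q)]. *)
Lemma R_factor_le u q : (0 < q)%N -> cabs u <= 1 ->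
  cabs ((1 + z * phi q u) / (1 + z / q%:R) - 1) <= 2 * exp_const / q%:R ^+ 2.
Proof.
move=> q0 u1; have d0 := disc_denom_neq0 q.
have -> : (1 + z * phi q u) / (1 + z / q%:R) - 1 =
    z * (phi q u - q%:R^-1) / (1 + z / q%:R).
  by apply: (mulIf d0); rewrite mulrBl !divfK //; ring.
rewrite cabsM cabsV ler_pdivrMr ?(lt_le_trans _ (disc_denom q)) //.
apply: le_trans (_ : 2 * exp_const / q%:R ^+ 2 <= _); last first.
  by rewrite ler_peMr ?disc_denom // divr_ge0 ?sqr_ge0 // mulr_ge0 // ltW ?exp_const_gt0.
rewrite cabsM -mulrA ler_pM ?cabs_ge0 ?disc_cabs //.
exact: phi_sub_inv_le.
Qed.

Definition Rpart (u : CC R) n := \prod_(1 <= q < n.+1) ((1 + z * phi q u) / (1 + z / q%:R)).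

Definition Rpart_const : R := 2 * (2 * exp_const) * expR (2 * (2 * exp_const)).

Lemma Rpart_cvg u n : cabs u <= 1 ->
  cabs (Rpart u n) <= expR (2 * (2 * exp_const)) /\
  cabs (Rpart u n - Rprod u z) <= Rpart_const / n.+1%:R.
Proof.
move=> u1; pose a q := (1 + z * phi q u) / (1 + z / q%:R) - 1.
have K0 : 0 <= 2 * exp_const by rewrite mulr_ge0 // ltW ?exp_const_gt0.
have aA q : (0 < q)%N -> cabs (a q) <= 2 * exp_const / q%:R ^+ 2.
  by move=> q0; apply: R_factor_le.
have aE N : \prod_(1 <= q < N.+1) (1 + a q) = Rpart u N.
  by apply: eq_bigr => q _; rewrite /a subrKC.
split; first by rewrite -aE prod_le_expR.
have := prod_cvg_rate K0 aA n; rewrite aE.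
by under [X in lim (X @ _)]funext do rewrite aE.
Qed.

End Disc.

(** The bounds hold at [q = 1] as well, because [ln 0 = 0]. *)
Lemma ln_step_bounds q : (0 < q)%N ->
  0 <= ln (q%:R : R) - ln q.-1%:R <= 2 / q%:R /\
  `|ln (q%:R : R) - ln q.-1%:R - q%:R^-1| <= 2 / q%:R ^+ 2.
Proof.
case: q => // -[_|n _] /=.
  by rewrite ln1 ln0 // !subrr sub0r normrN expr1n !invr1 normr1; split; lra.
have n1 : 0 < n.+1%:R :> R by rewrite ltr0n.
have n2 : 0 < n.+2%:R :> R by rewrite ltr0n.
have n1e : n.+1%:R != 0 :> R by rewrite gt_eqF.
have n2e : n.+2%:R != 0 :> R by rewrite gt_eqF.
set l := ln n.+2%:R - ln n.+1%:R.
have up : l <= n.+1%:R^-1.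
  rewrite /l -ln_div ?posrE //.
  have -> : n.+2%:R / n.+1%:R = 1 + n.+1%:R^-1 :> R.
    by rewrite -(natr1 n.+1) mulrDl divff // mul1r.
  by apply: le_ln1Dx; rewrite (lt_trans (ltrN10 _)) // invr_gt0.
have lo : n.+2%:R^-1 <= l.
  rewrite -lerN2 /l opprB -ln_div ?posrE //.
  have -> : n.+1%:R / n.+2%:R = 1 + - n.+2%:R^-1 :> R.
    have -> : n.+1%:R = n.+2%:R - 1 :> R by rewrite -(natr1 n.+1) addrK.
    by rewrite mulrBl divff // mul1r.
  apply: le_ln1Dx; rewrite ltrN2 invf_lt1 // ltr1n.
  by [].
have gap : n.+1%:R^-1 - n.+2%:R^-1 <= 2 / n.+2%:R ^+ 2 :> R.
  have -> : n.+1%:R^-1 - n.+2%:R^-1 = (n.+2%:R - n.+1%:R) / (n.+1%:R * n.+2%:R) :> R.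
    exact: inv_sub.
  rewrite -natrB // subSnn ler_pdivrMr ?mulr_gt0 // mulrAC ler_pdivlMr ?exprn_gt0 //.
  rewrite mul1r expr2 -!natrM ler_nat mulnA leq_mul2r /=.
  by rewrite mul2n -addnn addSn ltnS addnS ltnS leq_addr.
have i0 : 0 < n.+2%:R^-1 :> R by rewrite invr_gt0.
have i1 : n.+1%:R^-1 <= 2 / n.+2%:R :> R.
  rewrite -[leLHS]mul1r ler_pdivrMr // mulrAC ler_pdivlMr // mul1r -natrM ler_nat.
  by rewrite mul2n -addnn addSn ltnS addnS ltnS leq_addr.
split; last by rewrite ger0_norm ?subr_ge0 // (le_trans _ gap) // lerD2r.
by rewrite (le_trans (ltW i0) lo) (le_trans up i1).
Qed.

(** The ratio of two consecutive terms of [gauss_part], in which the powers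
    [n ^ (- z)] have been telescoped. *)
Definition gauss_factor q z : CC R := (1 + z / q%:R) * cexp (- (z * (ln q%:R - ln q.-1%:R)%:C)).

(** The reciprocal of Gauss's approximation of [Gamma (1 + z)]. *)
Definition gauss_part n z : CC R := \prod_(1 <= q < n.+1) (1 + z / q%:R) * cpow n%:R (- z).

Lemma gauss_part_prod n z : \prod_(1 <= q < n.+1) gauss_factor q z = gauss_part n z.
Proof.
rewrite big_split /= /gauss_part; congr (_ * _); rewrite /cpow.
elim: n => [|n IH].
  by rewrite big_geq // ln0 // mulr0 cexp0.
rewrite big_nat_recr //= IH -cexpD; congr cexp.
by rewrite rmorphB /=; ring.
Qed.

Definition gauss_const : R := 2 * 2 + 4 * 2 + 3 * (exp_const * 16).

Lemma gauss_const_ge0 : 0 <= gauss_const.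
Proof. by rewrite /gauss_const; have := exp_const_gt0; lra. Qed.

(** Expanding [cexp] to first order, the terms [z / q] and [- z l], with [l]
    the increment of the logarithm, cancel up to [O (1 / q ^ 2)]. *)
Lemma gauss_factor_le q z : (0 < q)%N -> cabs z <= 2 ->
  cabs (gauss_factor q z - 1) <= gauss_const / q%:R ^+ 2.
Proof.
move=> q0 z2; have [/andP[l0 l2] lq] := ln_step_bounds q0.
set l := ln _ - _ in l0 l2 lq; have K0 := exp_const_gt0.
have qR : 0 < q%:R :> R by rewrite ltr0n.
have q1 : 1 <= q%:R :> R by rewrite ler1n.
have zl : cabs (- (z * l%:C)) <= 4 / q%:R.
  rewrite cabsN cabsM cabs_real (ger0_norm l0).
  have -> : 4 / q%:R = 2 * (2 / q%:R) :> R by ring.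
  by rewrite ler_pM ?cabs_ge0.
have zl4 : cabs (- (z * l%:C)) <= 4.
  by rewrite (le_trans zl) // ler_pdivrMr // ler_peMr.
pose r := cexp (- (z * l%:C)) - 1 - - (z * l%:C).
have rb : cabs r <= exp_const * 16 / q%:R ^+ 2.
  rewrite (le_trans (cexp_quadratic4 zl4)) // -mulrA ler_pM2l //.
  have -> : 16 / q%:R ^+ 2 = (4 / q%:R) ^+ 2 :> R by rewrite expr_div_n; congr (_ / _); ring.
  by rewrite lerXn2r ?nnegrE ?cabs_ge0 // divr_ge0 // ltW.
have -> : gauss_factor q z - 1 =
    - (z * (l - q%:R^-1)%:C) - z * z * (l%:C / q%:R) + (1 + z / q%:R) * r.
  have -> : (l - q%:R^-1)%:C = l%:C - q%:R^-1 :> CC R.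
    by rewrite realCB realCV realC_nat.
  by rewrite /gauss_factor /r -/l; ring.
have -> : gauss_const / q%:R ^+ 2 =
    2 * (2 / q%:R ^+ 2) + (2 * 2) * (2 / q%:R ^+ 2) + 3 * (exp_const * 16 / q%:R ^+ 2).
  by rewrite /gauss_const; ring.
rewrite (le_trans (cabsD _ _)) // lerD //.
  rewrite (le_trans (cabsD _ _)) // !cabsN lerD //.
    by rewrite cabsM cabs_real ler_pM ?cabs_ge0.
  rewrite !cabsM cabsV cabs_nat cabs_real (ger0_norm l0).
  rewrite ler_pM ?mulr_ge0 ?cabs_ge0 ?invr_ge0 ?(ltW qR) //.
    by rewrite ler_pM ?cabs_ge0.
  by rewrite expr2 invfM mulrA ler_pM2r ?invr_gt0.
rewrite cabsM ler_pM ?cabs_ge0 //.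
have -> : 3 = 1 + 2 :> R by ring.
rewrite (le_trans (cabsD _ _)) // cabs1 lerD2l cabsM cabsV cabs_nat.
by rewrite ler_pdivrMr // (le_trans z2) // ler_peMr.
Qed.

Definition gauss_lim z : CC R := lim ((fun n => gauss_part n z) @ \oo).

Lemma gauss_part_cvg n z : cabs z <= 2 ->
  cabs (gauss_part n z) <= expR (2 * gauss_const) /\
  cabs (gauss_part n z - gauss_lim z) <= 2 * gauss_const * expR (2 * gauss_const) / n.+1%:R.
Proof.
move=> z2; pose a q := gauss_factor q z - 1.
have aA q : (0 < q)%N -> cabs (a q) <= gauss_const / q%:R ^+ 2.
  by move=> q0; apply: gauss_factor_le.
have aE N : \prod_(1 <= q < N.+1) (1 + a q) = gauss_part N z.
  by rewrite -gauss_part_prod; apply: eq_bigr => q _; rewrite /a subrKC.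
split; first by rewrite -aE (prod_le_expR _ gauss_const_ge0 aA).
have := prod_cvg_rate gauss_const_ge0 aA n; rewrite aE.
by under [X in lim (X @ _)]funext do rewrite aE.
Qed.

End Products.

(** * Euler's integral as the limit of beta integrals *)

Section BetaSum.
Variable F : fieldType.

(** The value at [1] of the antiderivative of [t ^ z * (1 - t) ^ n], in
    factored form; the recursion in [n] is integration by parts. *)
Lemma beta_sum n (z : F) : (forall k, (k <= n)%N -> z + k.+1%:R != 0) ->
  \sum_(k < n.+1) (-1) ^+ k * 'C(n, k)%:R / (z + k.+1%:R)
    = n`!%:R / \prod_(k < n.+1) (z + k.+1%:R).
Proof.
elim: n z => [|n IH] z z0.
  by rewrite !big_ord_recl !big_ord0 /= expr0 bin0 mulr1 addr0 mulr1.
have z1 : z + 1 != 0 by exact: z0 0%N _.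
rewrite [in RHS]big_ord_recl /=.
have -> : \prod_(i < n.+1) (z + (bump 0 i).+1%:R) = \prod_(i < n.+1) (z + 1 + i.+1%:R).
  by apply: eq_bigr => i _; rewrite /bump add1n -addrA nat1r.
rewrite invfM mulrCA factS natrM -mulrA -IH; last first.
  by move=> k kn; rewrite -addrA nat1r z0.
apply: (mulfI z1); rewrite mulVKf //.
rewrite mulr_sumr.
have term (k : 'I_n.+2) : (z + 1) * ((-1) ^+ k * 'C(n.+1, k)%:R / (z + k.+1%:R)) =
    (-1) ^+ k * 'C(n.+1, k)%:R - (-1) ^+ k * (k%:R * 'C(n.+1, k)%:R) / (z + k.+1%:R).
  have zk : z + k.+1%:R != 0 by apply: z0; rewrite -ltnS.
  apply: (mulIf zk); rewrite mulrBl !mulrA !divfK //.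
  by rewrite -natr1; ring.
under eq_bigr do rewrite term.
rewrite sumrB.
have -> : \sum_(k < n.+2) (-1) ^+ k * 'C(n.+1, k)%:R = 0 :> F.
  have := exprDn (1 : F) (-1) n.+1; rewrite subrr expr0n /= => E; rewrite [RHS]E.
  by apply: eq_bigr => k _; rewrite expr1n mul1r mulr_natr.
rewrite sub0r big_ord_recl /= mul0r mulr0 mul0r add0r mulr_sumr -sumrN.
apply: eq_bigr => k _; rewrite /bump add1n -natrM -mul_bin_diag natrM exprS.
have -> : z + k.+2%:R = z + 1 + k.+1%:R by rewrite -addrA nat1r.
by ring.
Qed.

End BetaSum.

Section RealPaths.
Variable R : realType.
(* [pr] stands for the real or the imaginary part, which obey the same
   argument. *)
Variable pr : CC R -> R.
Hypothesis prD : forall x y, pr (x + y) = pr x + pr y.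
Hypothesis prZ : forall (a : R) (x : CC R), pr ((a%:C : CC R) * x) = a * pr x.
Hypothesis pr_le : forall x, `|pr x| <= cabs x.
Implicit Types (s c w z : CC R) (t y h : R).

Lemma pr0 : pr 0 = 0.
Proof. by have := prZ 0 0; rewrite mulr0 mul0r. Qed.

Lemma prB (x y : CC R) : pr (x - y) = pr x - pr y.
Proof. by have := prD (x - y) y; rewrite subrK => ->; rewrite addrK. Qed.

Lemma pr_sum (I : Type) (r : seq I) (P : pred I) (F : I -> CC R) :
  pr (\sum_(i <- r | P i) F i) = \sum_(i <- r | P i) pr (F i).
Proof. by apply: (big_morph pr prD pr0). Qed.

Lemma is_derive_quadratic (G : R -> R) y l (d C : R) : 0 < d ->
  (forall h, `|h| <= d -> `|G (h + y) - G y - h * l| <= C * `|h| ^+ 2) ->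
  is_derive y 1 G l.
Proof.
move=> d0 GC.
suff H : (fun h : R => h^-1 *: (G (h + y) - G y)) @ 0^' --> l.
  have H' : (fun h : R => h^-1 *: (G (h *: 1 + y) - G y)) @ 0^' --> l.
    apply: cvg_trans H; apply: near_eq_cvg; near=> h.
    by rewrite /= [h%:A]mulr1.
  split; first by apply/cvg_ex; exists l; exact: H'.
  by apply/cvg_lim; [exact: Rhausdorff|exact: H'].
apply/cvgrPdist_lt => e e0.
have C1 : 0 < `|C| + 1 by rewrite ltr_wpDl.
pose r := Num.min d (e / (`|C| + 1)).
have r0 : 0 < r by rewrite lt_min d0 divr_gt0.
near=> h.
have h0 : h != 0 by near: h; exact: nbhs_dnbhs_neq.
have hr : `|h| < r.
  near: h; apply: dnbhs0_lt => //.
have -> : l - h^-1 *: (G (h + y) - G y) = - (h^-1 * (G (h + y) - G y - h * l)).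
  by rewrite [in RHS]mulrBr mulKf // opprB.
rewrite normrN normrM normfV mulrC ltr_pdivrMr ?normr_gt0 //.
move: hr; rewrite lt_min ltr_pdivlMr // => /andP[/ltW hd he].
rewrite (le_lt_trans (GC _ hd)) // expr2 mulrA ltr_pM2r ?normr_gt0 //.
have := ler_norm C; have := normr_ge0 h; nra.
Unshelve. all: by end_near.
Qed.

Lemma ReM_real s t : complex.Re (s * t%:C) = complex.Re s * t.
Proof. by case: s => a b /=; rewrite mulr0 subr0. Qed.

Lemma is_derive_pr_cexp c s y :
  is_derive y 1 (fun y => pr (c * cexp (s * y%:C))) (pr (c * s * cexp (s * y%:C))).
Proof.
pose d : R := (2 * (cabs s + 1))^-1.
have s1 : 0 < cabs s + 1 by rewrite ltr_wpDl // cabs_ge0.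
have d0 : 0 < d by rewrite invr_gt0 mulr_gt0.
pose C := cabs c * cabs (cexp (s * y%:C)) * (16 * cabs s ^+ 2).
apply: (@is_derive_quadratic _ _ _ d C d0) => h hd.
rewrite -prZ -!prB; apply: le_trans (pr_le _) _.
have -> : c * cexp (s * (h + y)%:C) - c * cexp (s * y%:C) - h%:C * (c * s * cexp (s * y%:C))
    = c * cexp (s * y%:C) * (cexp (s * h%:C) - 1 - s * h%:C).
  by rewrite [(h + y)%:C](rmorphD (real_complex R)) mulrDr cexpD; ring.
rewrite !cabsM /C -!mulrA; do 2 (rewrite ler_wpM2l ?cabs_ge0 //).
have sh : cabs (s * h%:C) = cabs s * `|h| by rewrite cabsM cabs_real.
rewrite (le_trans (cexp_quadratic _)) // sh ?exprMn //.
have : `|h| * (2 * (cabs s + 1)) <= 1.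
  by rewrite -ler_pdivlMr ?mulr_gt0 // mul1r.
have := normr_ge0 h; have := cabs_ge0 s; nra.
by rewrite expr2 !mulrA.
Qed.

(** [t ^ s] extended by [0] to [t <= 0]; unlike [cpow], it is continuous at
    [0] when [0 < Re s]. *)
Definition tpow t s : CC R := if t <= 0 then 0 else cpow t s.

Lemma tpowE t s : 0 < t -> tpow t s = cexp (s * (ln t)%:C).
Proof. by move=> t0; rewrite /tpow leNgt t0. Qed.

Lemma cexp_real t : cexp t%:C = (expR t)%:C :> CC R.
Proof. by rewrite /= sin0 cos0 mulr1 mulr0. Qed.

Lemma tpow_natD t s k : 0 < t -> tpow t (s + k%:R) = tpow t s * (t ^+ k)%:C.
Proof.
move=> t0; rewrite !tpowE // mulrDl cexpD cexpMn cexp_real lnK ?posrE //.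
by rewrite [(t ^+ k)%:C](rmorphXn (real_complex R)).
Qed.

Lemma cabs_tpow t s : 0 < t -> cabs (tpow t s) = expR (complex.Re s * ln t).
Proof. by move=> t0; rewrite tpowE // cabs_cexp ReM_real. Qed.

Lemma is_derive_tpow c s t : 0 < t ->
  is_derive t 1 (fun t => pr (c * tpow t s)) (pr (c * s * tpow t (s - 1))).
Proof.
move=> t0.
have := @is_derive1_comp R _ _ t _ _ (is_derive_pr_cexp c s (ln t)) (is_derive1_ln t0).
have -> : pr (c * s * cexp (s * (ln t)%:C)) * t^-1 = pr (c * s * tpow t (s - 1)).
  rewrite mulrC -prZ tpowE // mulrBl mul1r cexpD -[- _%:C](rmorphN (real_complex R)).
  by rewrite cexp_real expRN lnK ?posrE //; congr pr; ring.
apply: near_eq_is_derive; near=> x.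
rewrite /= tpowE //.
by near: x; exact: lt_nbhsr.
Unshelve. all: by end_near.
Qed.

Lemma continuous_tpow c s : 0 < complex.Re s -> continuous (fun t => pr (c * tpow t s)).
Proof.
move=> s0 t.
have [t0|t0|->] := ltgtP t 0.
- apply: cvg_trans (_ : cst 0 @ t --> _); last first.
    by rewrite {1}/tpow (ltW t0) mulr0 pr0; exact: cvg_cst.
  apply: near_eq_cvg; near=> x.
  rewrite /= /tpow ifT ?mulr0 ?pr0 //.
  by apply/ltW; near: x; exact: lt_nbhsl.
- have [D _] := is_derive_tpow c s t0.
  exact/differentiable_continuous/derivable1_diffP.
- rewrite /continuous_at; have -> : pr (c * tpow 0 s) = 0 by rewrite /tpow lexx mulr0 pr0.
  apply/cvgrPdist_lt => e e0.
  have c1 : 0 < cabs c + 1 by rewrite ltr_wpDl // cabs_ge0.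
  pose d : R := expR (ln (e / (cabs c + 1)) / complex.Re s).
  near=> x; rewrite sub0r normrN.
  have [x0|x0] := leP x 0; first by rewrite /tpow x0 mulr0 pr0 normr0.
  have xd : x < d.
    by near: x; apply: lt_nbhsl; exact: expR_gt0.
  rewrite (le_lt_trans (pr_le _)) // cabsM cabs_tpow //.
  apply: le_lt_trans (_ : (cabs c + 1) * expR (complex.Re s * ln x) < _).
    by rewrite ler_wpM2r ?expR_ge0 // lerDl.
  rewrite mulrC -ltr_pdivlMr // -[ltRHS]lnK ?posrE ?divr_gt0 // ltr_expR.
  rewrite mulrC -ltr_pdivlMr //.
  by rewrite -[ltRHS]expRK ltr_ln ?posrE ?expR_gt0.
Unshelve. all: by end_near.
Qed.

Lemma continuous_sum_tpow N (c s : 'I_N -> CC R) :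
  (forall k, 0 < complex.Re (s k)) ->
  continuous (fun t => \sum_(k < N) pr (c k * tpow t (s k))).
Proof.
move=> s0; elim: N c s s0 => [|N IH] c s s0.
  have -> : (fun t => \sum_(k < 0) pr (c k * tpow t (s k))) = cst 0.
    by apply/funext => t; rewrite big_ord0.
  by move=> t; exact: cvg_cst.
have -> : (fun t => \sum_(k < N.+1) pr (c k * tpow t (s k))) =
  (fun t => pr (c ord0 * tpow t (s ord0)) +
     \sum_(k < N) pr (c (lift ord0 k) * tpow t (s (lift ord0 k)))).
  by apply/funext => t; rewrite big_ord_recl.
move=> t; apply: cvgD; first exact: continuous_tpow.
exact: (IH (fun k => c (lift ord0 k)) (fun k => s (lift ord0 k))).
Qed.

(** The fundamental theorem of calculus applied termwise to the primitives
    [t ^ (s + 1) / (s + 1)], which vanish at [0]. *)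
Lemma integral_sum_tpow N (c s : 'I_N -> CC R) (a : R) : 0 < a ->
  (forall k, 0 < complex.Re (s k)) ->
  (\int[lebesgue_measure]_(t in `[0%R, a]) (\sum_(k < N) pr (c k * tpow t (s k)))%:E
   = (\sum_(k < N) pr (c k / (s k + 1) * tpow a (s k + 1)))%:E)%E.
Proof.
move=> a0 s0.
have s1 k : 0 < complex.Re (s k + 1).
  by have := s0 k; case: (s k) => u v /=; lra.
have s1' k : s k + 1 != 0.
  by apply/eqP => E; have := s1 k; rewrite E ltxx.
pose F t := \sum_(k < N) pr (c k / (s k + 1) * tpow t (s k + 1)).
have Fc : continuous F by apply: continuous_sum_tpow.
have dF t : 0 < t -> is_derive t 1 F (\sum_(k < N) pr (c k * tpow t (s k))).
  move=> t0.
  have -> : F = \sum_(k < N) (fun t => pr (c k / (s k + 1) * tpow t (s k + 1))).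
    by apply/funext => x; rewrite fct_sumE.
  apply: is_derive_sum => k.
  have := is_derive_tpow (c k / (s k + 1)) (s k + 1) t0.
  by rewrite divfK // addrK.
rewrite (@continuous_FTC2 R _ F 0 a a0).
- rewrite -EFinB; congr (_%:E); rewrite /F [X in _ - X]big1 ?subr0 // => k _.
  by rewrite /tpow lexx mulr0 pr0.
- by apply: continuous_subspaceT; exact: continuous_sum_tpow.
- split.
  + by move=> t; rewrite in_itv /= => /andP[/dF[]].
  + by apply: cvg_at_right_filter; exact: Fc.
  + by apply: cvg_at_left_filter; exact: Fc.
- move=> t; rewrite in_itv /= => /andP[t0 _]; rewrite derive1E.
  by have [_ ->] := dF _ t0.
Qed.

End RealPaths.

Section GammaLimit.
Variable R : realType.
Variable pr : CC R -> R.
Hypothesis prD : forall x y, pr (x + y) = pr x + pr y.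
Hypothesis prZ : forall (a : R) (x : CC R), pr ((a%:C : CC R) * x) = a * pr x.
Hypothesis pr_le : forall x, `|pr x| <= cabs x.
Variable z : CC R.
Hypothesis z1 : cabs (z - 1) <= 2^-1.
Implicit Types (t : R).

Local Notation mu := (@lebesgue_measure R).

Definition beta_coef N k : R := (-1) ^+ k * 'C(N, k)%:R / N%:R ^+ k.

(** The binomial expansion of [pr (t ^ z) * (1 - t / N) ^ N]; the sum of powers
    of [t] is the form that can be integrated explicitly. *)
Definition beta_integrand N t : R :=
  \sum_(k < N.+1) pr ((beta_coef N k)%:C * tpow t (z + k%:R)).

(** The integral of [t ^ z * (1 - t / N) ^ N] over [0, N], equal to
    [N ^ (z + 1) * N! / ((z + 1) ... (z + N + 1))]. *)
Definition beta_value N : CC R :=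
  cpow N%:R (z + 1) * (N`!%:R / \prod_(k < N.+1) (z + k.+1%:R)).

Lemma disc_Re_shift k : 0 < complex.Re (z + k%:R).
Proof.
rewrite -(rmorph_nat (real_complex R)).
have zr := disc_Re z1; have k0 : 0 <= k%:R :> R by [].
by move: zr k0; move: (k%:R) => x; case: (z) => a b /=; lra.
Qed.

Lemma disc_shift_neq0 k : z + k%:R != 0.
Proof. by apply/eqP => E; have := disc_Re_shift k; rewrite E ltxx. Qed.

Lemma beta_integrandE N t : 0 < t ->
  beta_integrand N t = (1 - t / N%:R) ^+ N * pr (tpow t z).
Proof.
move=> t0; rewrite /beta_integrand exprDn mulr_suml; apply: eq_bigr => k _.
rewrite tpow_natD //.
have -> : (beta_coef N k)%:C * (tpow t z * (t ^+ k)%:C) =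
    (beta_coef N k * t ^+ k)%:C * tpow t z.
  by rewrite realCM; ring.
rewrite prZ; congr (_ * _).
by rewrite /beta_coef -[RHS]mulr_natr expr1n [in RHS]exprNn expr_div_n; ring.
Qed.

Lemma integral_beta N : (0 < N)%N ->
  (\int[mu]_(t in `[0%R, N%:R]) (beta_integrand N t)%:E = (pr (beta_value N))%:E)%E.
Proof.
move=> N0; have NR : 0 < N%:R :> R by rewrite ltr0n.
rewrite (@integral_sum_tpow R pr prD prZ pr_le) //; last by move=> k; exact: disc_Re_shift.
congr (_%:E); rewrite -(pr_sum prD prZ); congr pr.
rewrite /beta_value -beta_sum; last by move=> k _; exact: disc_shift_neq0.
rewrite mulr_sumr; apply: eq_bigr => k _.
have -> : z + k%:R + 1 = z + 1 + k%:R by rewrite addrAC.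
have -> : z + k.+1%:R = z + 1 + k%:R by rewrite -addrA nat1r.
rewrite tpow_natD // tpowE // -/(cpow _ _).
have -> : (beta_coef N k)%:C = (-1) ^+ k * 'C(N, k)%:R / N%:R ^+ k :> CC R.
  by rewrite /beta_coef !realCM realCV !realCX realCN !realC_nat.
have -> : (N%:R ^+ k)%:C = N%:R ^+ k :> CC R.
  by rewrite realCX realC_nat.
have Nk : N%:R ^+ k != 0 :> CC R by rewrite expf_neq0 // pnatr_eq0 -lt0n.
set a := (-1) ^+ k; set b := 'C(N, k)%:R; set d := cpow _ _.
have -> : a * b / N%:R ^+ k / (z + 1 + k%:R) * (d * N%:R ^+ k) =
    d * (a * b / (z + 1 + k%:R)) * (N%:R ^+ k / N%:R ^+ k) by ring.
by rewrite divff // mulr1.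
Qed.

(** The slope [1/3] is such that [Re z * ln t], with [Re z] at most [3/2], uses
    up only half of the decay of [expR (- t)]. *)
Lemma ln_le_third t : 0 < t -> ln t <= t / 3 + ln 3.
Proof.
move=> t0; have t3 : 0 < t / 3 by rewrite divr_gt0.
have -> : ln t = ln (t / 3) + ln 3 by rewrite ln_div ?posrE // subrK.
rewrite lerD2r.
have := @le_ln1Dx R (t / 3 - 1); rewrite addrCA subrr addr0 => /(_ _)/le_trans.
by apply; lra.
Qed.

Lemma Re_le : complex.Re z <= 3 / 2.
Proof.
have := le_trans (cabs_Re _) z1; rewrite ler_norml => /andP[_].
by case: (z) => a b /=; lra.
Qed.

Definition dominating t : R := 2 * expR (3 / 2 * ln 3) * exponential_pdf 2^-1 t.

Lemma pr_tpow_expR_le t : 0 < t ->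
  `|pr (tpow t z)| * expR (- t) <= dominating t.
Proof.
move=> t0; rewrite /dominating exponential_pdfE ?(ltW t0) //=.
have -> : 2 * expR (3 / 2 * ln 3) * (2^-1 * expR (- 2^-1 * t)) =
   expR (3 / 2 * ln 3 + - 2^-1 * t) by rewrite expRD; lra.
apply: le_trans (_ : expR (complex.Re z * ln t) * expR (- t) <= _).
  by rewrite ler_wpM2r ?expR_ge0 // (le_trans (pr_le _)) // cabs_tpow.
rewrite -expRD ler_expR.
have lt := ln_le_third t0.
have l3 : 0 <= ln (3 : R) by apply: ln_ge0; lra.
have zr := disc_Re z1; have zl := Re_le.
have [l0|l0] := lerP (ln t) 0; nra.
Qed.

Lemma beta_integrand_le N t : (0 < N)%N -> 0 < t -> t <= N%:R ->
  `|beta_integrand N t| <= dominating t.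
Proof.
move=> N0 t0 tN; have NR : 0 < N%:R :> R by rewrite ltr0n.
rewrite beta_integrandE // normrM mulrC (le_trans _ (pr_tpow_expR_le t0)) //.
rewrite ler_wpM2l // ger0_norm; last first.
  by rewrite exprn_ge0 // subr_ge0 ler_pdivrMr // mul1r.
have -> : expR (- t) = expR (- (t / N%:R)) ^+ N.
  by rewrite -expRM_natl mulrN mulrC divfK ?gt_eqF.
rewrite lerXn2r ?nnegrE ?expR_ge0 //.
  by rewrite subr_ge0 ler_pdivrMr // mul1r.
by have := expR_ge1Dx (- (t / N%:R)).
Qed.

Lemma beta_integrand_cvg t : 0 < t ->
  (fun n => beta_integrand n.+1 t) @ \oo --> pr (tpow t z) * expR (- t).
Proof.
move=> t0.
under [X in X @ _]funext do rewrite beta_integrandE //.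
rewrite mulrC; apply: cvgM; last exact: cvg_cst.
apply/cvgrPdist_lt => e e0.
have [N NP] := exists_rate_lt (16 * t ^+ 2 * expR t) e0.
have h2 : 0 < 2^-1 :> R by rewrite invr_gt0.
have [M MP] := exists_rate_lt t h2.
exists (maxn N M) => // n /=; rewrite geq_max => /andP[Nn Mn].
have := @cexp_pow_rate R t n.+1 (- t)%:C (ltn0Sn n) (ltW t0).
rewrite cabs_real normrN gtr0_norm // lexx.
have -> : (cexp (- t)%:C - (1 + (- t)%:C / n.+1%:R) ^+ n.+1 : CC R) =
    (expR (- t) - (1 - t / n.+1%:R) ^+ n.+1)%:C.
  by rewrite cexp_real [RHS]realCB realCX realCB realCM realCV !realC_nat realCN mulNr.
rewrite cabs_real => H; apply: le_lt_trans (H _ isT) _.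
  apply/ltW; apply: le_lt_trans MP.
  by rewrite ler_pM2l // lef_pV2 ?posrE ?ltr0n // ler_nat ltnS.
apply: le_lt_trans NP.
rewrite ler_wpM2l ?mulr_ge0 ?sqr_ge0 ?expR_ge0 ?(ltW t0) //.
by rewrite lef_pV2 ?posrE ?ltr0n // ler_nat ltnS.

Qed.

Lemma measurable_beta_integrand N (D : set R) : measurable D ->
  measurable_fun D (beta_integrand N).
Proof.
move=> mD; apply: measurable_funS (measurableT) (@subsetT _ D) _.
apply: continuous_measurable_fun.
apply: (@continuous_sum_tpow R pr prD prZ pr_le) => k; exact: disc_Re_shift.
Qed.

Definition gamma_integrand t : R := pr (tpow t z) * expR (- t).

(** Dominated convergence: [(1 - t / N) ^ N], cut off at [t = N], tends to
    [expR (- t)], and the integrands are all below [dominating]. *)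
Lemma pr_Euler_limit :
  (fun n => pr (beta_value n.+1)) @ \oo -->
    (\int[mu]_(t in `]0%R, +oo[) gamma_integrand t)%R.
Proof.
pose D : set R := `]0%R, +oo[%classic.
have mD : measurable D by exact: measurable_itv.
pose E n : set R := `[0%R, n.+1%:R]%classic.
pose f n : R -> \bar R := (EFin \o beta_integrand n.+1) \_ (E n).
have intf n : (\int[mu]_(t in D) f n t = (pr (beta_value n.+1))%:E)%E.
  rewrite -integral_beta // /f -integral_mkcondr.
  have -> : D `&` E n = `]0%R, n.+1%:R]%classic.
    apply/seteqP; split => t /=; rewrite /D /E /= !in_itv /= ?andbT.
      by move=> [-> /andP[_ ->]].
    by move=> /andP[t0 ->]; rewrite t0 (ltW t0).
  rewrite integral_itv_obnd_cbnd //.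
  by apply/measurable_EFinP; apply: measurable_beta_integrand; exact: measurable_itv.
have mf n : measurable_fun D (f n).
  apply/measurable_restrict => //; first exact: measurable_itv.
  apply/measurable_EFinP; apply: measurable_beta_integrand.
  by apply: measurableI => //; exact: measurable_itv.
have mg : measurable_fun D (EFin \o gamma_integrand).
  apply/measurable_EFinP; apply: measurable_funS (measurableT) (@subsetT _ D) _.
  apply: measurable_funM; apply: continuous_measurable_fun.
    have -> : (fun t => pr (tpow t z)) = (fun t => pr (1 * tpow t z)).
      by apply/funext => t; rewrite mul1r.
    by apply: (continuous_tpow prD prZ pr_le); rewrite (lt_le_trans _ (disc_Re z1)).
  by move=> t; apply: continuous_comp; [exact: opp_continuous|exact: continuous_expR].
have idom : mu.-integrable D (EFin \o dominating).
  apply: (@integrableS _ _ _ mu setT) => //.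
  have h2 : 0 < 2^-1 :> R by rewrite invr_gt0.
  exact: (integrableZl measurableT (2 * expR (3 / 2 * ln 3)) (integrable_exponential_pdf h2)).
have pointwise : \forall t \ae mu, D t -> f n t @[n --> \oo] --> (gamma_integrand t)%:E.
  apply: aeW => t; rewrite /D /= in_itv /= andbT => t0.
  apply: cvg_trans (_ : (beta_integrand n.+1 t)%:E @[n --> \oo] --> _); last first.
    by apply: cvg_EFin; [exact: nearW|exact: beta_integrand_cvg].
  apply: near_eq_cvg; exists (Num.bound t) => // n /= tn.
  rewrite /f patchE ifT // inE /E /= in_itv /= (ltW t0) /=.
  rewrite ltW // (lt_le_trans (archi_boundP (ltW t0))) // ler_nat.
  exact: leqW.
have dominated : \forall t \ae mu, forall n, D t -> (`|f n t| <= (dominating t)%:E)%E.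
  apply: aeW => t n; rewrite /D /= in_itv /= andbT => t0.
  rewrite /f patchE; case: ifPn => [|_].
    rewrite inE /E /= in_itv /= => /andP[_ tn].
    by rewrite lee_fin beta_integrand_le.
  by rewrite abse0 lee_fin (le_trans _ (pr_tpow_expR_le t0)) // mulr_ge0 ?expR_ge0 ?normr_ge0 //.
have [ig _ cv] := @dominated_convergence _ _ R mu D mD f (EFin \o gamma_integrand)
  (EFin \o dominating) mf mg pointwise idom dominated.
rewrite /Rintegral -/D.
apply: cvg_trans (_ : (fine \o (fun n => \int[mu]_(t in D) f n t)%E) n @[n --> \oo] --> _).
  by apply: near_eq_cvg; apply: nearW => n /=; rewrite intf.
have fg : (\int[mu]_(t in D) (gamma_integrand t)%:E)%E \is a fin_num.
  exact: (@integrable_fin_num _ _ R mu D mD _ ig).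
apply: fine_cvg; rewrite fineK //.
Qed.

End GammaLimit.

(** * Gauss's product for the Gamma function *)

Section GammaInverse.
Variable R : realType.
Variable z : CC R.
Hypothesis z1 : cabs (z - 1) <= 2^-1.

(** Both are products of the same linear factors, apart from the factor
    [z + N + 1], so that their product tends to [1]. *)
Lemma beta_value_gauss_part N : (0 < N)%N ->
  beta_value z N * gauss_part N z = N%:R / (z + N.+1%:R).
Proof.
move=> N0; rewrite /beta_value /gauss_part.
have cp : cpow N%:R (z + 1) * cpow N%:R (- z) = N%:R :> CC R.
  rewrite /cpow -cexpD -mulrDl (_ : z + 1 + - z = 1); last by ring.
  by rewrite mul1r cexp_real lnK ?posrE ?ltr0n // realC_nat.
have pr1 : \prod_(1 <= q < N.+1) (1 + z / q%:R) * N`!%:R = \prod_(k < N) (z + k.+1%:R).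
  rewrite big_add1 /= big_mkord.
  elim: N {N0 cp} => [|n IH]; first by rewrite !big_ord0 mul1r.
  rewrite !big_ord_recr /= -IH factS natrM.
  have n0 : n.+1%:R != 0 :> CC R by rewrite pnatr_eq0.
  rewrite -[X in _ = _ * X](divfK n0) [_ + n.+1%:R]addrC mulrDl divff //.
  by ring.
have P0 : \prod_(k < N) (z + k.+1%:R) != 0.
  by apply/prodf_neq0 => k _; exact: disc_shift_neq0.
have zN : z + N.+1%:R != 0 by exact: disc_shift_neq0.
rewrite big_ord_recr /=.
set P := \prod_(k < N) _ in pr1 P0 *; set Q := \prod_(_ <= _ < _) _ in pr1 *.
have -> : cpow N%:R (z + 1) * (N`!%:R / (P * (z + N.+1%:R))) * (Q * cpow N%:R (- z)) =
  (cpow N%:R (z + 1) * cpow N%:R (- z)) * ((Q * N`!%:R) / (P * (z + N.+1%:R))) by ring.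
by rewrite cp pr1 invfM mulVKf.
Qed.

Lemma beta_value_cvg : (fun n => beta_value z n.+1) @ \oo --> Gamma (1 + z).
Proof.
pose rez (x : CC R) : R := complex.Re (x : R[i]); pose imz (x : CC R) : R := complex.Im (x : R[i]).
have reD x y : rez (x + y) = rez x + rez y by case: x y => [? ?] [? ?].
have imD x y : imz (x + y) = imz x + imz y by case: x y => [? ?] [? ?].
have reZ (a : R) x : rez ((a%:C : CC R) * x) = a * rez x.
  by case: x => ? ?; rewrite /rez /= mul0r subr0.
have imZ (a : R) x : imz ((a%:C : CC R) * x) = a * imz x.
  by case: x => ? ?; rewrite /imz /= mul0r addr0.
have re := pr_Euler_limit reD reZ (@cabs_Re R) z1.
have im := pr_Euler_limit imD imZ (@cabs_Im R) z1.
have E (p : CC R -> R) : (forall (a : R) x, p ((a%:C : CC R) * x) = a * p x) ->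
    (\int[lebesgue_measure]_(t in `]0%R, +oo[) gamma_integrand p z t)%R =
    (\int[lebesgue_measure]_(t in `]0%R, +oo[)
      p (cpow t (1 + z - 1) * (expR (- t))%:C))%R.
  move=> pZ; apply: eq_Rintegral => t; rewrite inE /= in_itv /= andbT => t0.
  by rewrite /gamma_integrand addrC addKr [(_ * _%:C)]mulrC pZ mulrC tpowE.
have GE : Gamma (1 + z) =
  (\int[lebesgue_measure]_(t in `]0%R, +oo[) gamma_integrand rez z t)%R
  +i* (\int[lebesgue_measure]_(t in `]0%R, +oo[) gamma_integrand imz z t)%R.
  by rewrite (E _ reZ) (E _ imZ).
move: re im; rewrite GE; set a := Rintegral _ _ _; set b := Rintegral _ _ _.
move=> re im; apply/cvg_cabsP => e e0.
have /cvgrPdist_lt/(_ _ (divr_gt0 e0 (ltr0n R 2))) [N1 _ H1] := re.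
have /cvgrPdist_lt/(_ _ (divr_gt0 e0 (ltr0n R 2))) [N2 _ H2] := im.
exists (maxn N1 N2) => n; rewrite geq_max => /andP[n1 n2].
have /= := H1 n n1; have /= := H2 n n2.
have := cabs_ReIm (beta_value z n.+1 - (a +i* b)); rewrite /rez /imz.
case: (beta_value z n.+1) => x y /=; rewrite (distrC a) (distrC b); lra.
Qed.

(** The product of [beta_value] and [gauss_part] tends both to
    [Gamma (1 + z) * gauss_lim z] and to [1]. *)
Lemma gauss_lim_Gamma : gauss_lim z * Gamma (1 + z) = 1.
Proof.
have z2 := disc_cabs z1.
have G : (fun n => gauss_part n.+1 z) @ \oo --> gauss_lim z.
  apply: (@cvg_rate R _ _ (2 * gauss_const R * expR (2 * gauss_const R))) => n.
  rewrite (le_trans (proj2 (gauss_part_cvg n.+1 z2))) // ler_wpM2l //.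
    by rewrite mulr_ge0 ?expR_ge0 // mulr_ge0 // gauss_const_ge0.
  by rewrite lef_pV2 ?posrE ?ltr0n // ler_nat.
have one : (fun n => beta_value z n.+1 * gauss_part n.+1 z) @ \oo --> (1 : CC R).
  apply: (@cvg_rate R _ _ 3) => n; rewrite beta_value_gauss_part //.
  have zn := disc_shift_neq0 z1 n.+2.
  have -> : n.+1%:R / (z + n.+2%:R) - 1 = - (z + 1) / (z + n.+2%:R).
    by apply: (mulIf zn); rewrite mulrBl !divfK // -(natr1 n.+1); ring.
  rewrite cabsM cabsN cabsV.
  have zn1 : n.+1%:R <= cabs (z + n.+2%:R).
    apply: le_trans (cabs_Re _); apply: le_trans (ler_norm _).
    have := disc_Re z1; rewrite -realC_nat -(natr1 n.+1).
    by case: (z) => a b /=; lra.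
  rewrite ler_pM ?cabs_ge0 ?invr_ge0 ?cabs_ge0 //.
    by rewrite (le_trans (cabsD _ _)) // cabs1; lra.
  by rewrite lef_pV2 ?posrE ?ltr0n // (lt_le_trans _ zn1) // ltr0n.
have := cvg_unique (@norm_hausdorff _ _) (cvgM beta_value_cvg G) one.
by rewrite mulrC; apply.
Qed.

Lemma invr_Gamma : (Gamma (1 + z))^-1 = gauss_lim z.
Proof.
have G0 : Gamma (1 + z) != 0.
  by apply/eqP => E; have := gauss_lim_Gamma; rewrite E mulr0 => /esym/eqP; rewrite oner_eq0.
by apply: (mulIf G0); rewrite mulVf // gauss_lim_Gamma.
Qed.

End GammaInverse.

(** * The generating function of the sums over partitions *)

Section GeneratingFunction.
Variable F : fieldType.
Implicit Types (z : F).

Definition nonzero_parts n (f : 'I_n -> nat) : seq nat :=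
  [seq e <- [seq f k | k : 'I_n] | e != 0%N].

Lemma size_nonzero_parts n (f : 'I_n -> nat) :
  size (nonzero_parts f) = (\sum_(k < n) (f k != 0))%N.
Proof.
rewrite size_filter -sum1_count big_map big_enum_cond big_mkcond.
by apply: eq_bigr => k _; case: eqP.
Qed.

Lemma sumn_nonzero_parts n (f : 'I_n -> nat) :
  sumn (nonzero_parts f) = (\sum_(k < n) f k)%N.
Proof.
rewrite sumnE big_filter big_map big_enum_cond big_mkcond.
by apply: eq_bigr => k _; case: eqP.
Qed.

Lemma prod_fact_nonzero_parts n (f : 'I_n -> nat) :
  \prod_(p <- nonzero_parts f) p`!%:R = \prod_(k < n) (f k)`!%:R :> F.
Proof.
rewrite big_filter big_map big_enum_cond big_mkcond.
by apply: eq_bigr => k _; case: eqP => // ->.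
Qed.

Lemma mem_leq_sumn (s : seq nat) x : x \in s -> (x <= sumn s)%N.
Proof.
elim: s => // y s IH; rewrite inE => /orP[/eqP->|/IH]; rewrite /= ?leq_addr //.
by move=> /leq_trans->//; rewrite leq_addl.
Qed.

(** A multiset of positive parts has exactly one nonincreasing arrangement. *)
Lemma sum_partitions_perm i j (s : seq nat) (c : F) : 0%N \notin s ->
  \sum_(mu : i.-tuple 'I_j.+1 | is_partition j (map val mu) && perm_eq s (map val mu)) c
  = if (size s == i) && (sumn s == j) then c else 0.
Proof.
move=> s0; case: ifPn => [/andP[/eqP si /eqP sj]|H]; last first.
  apply: big_pred0 => mu; apply/negP => /andP[/and3P[_ _ /eqP sm] pe].
  move: H; rewrite (perm_size pe) size_map size_tuple eqxx /=.
  by rewrite (perm_sumn pe) sm eqxx.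
pose t0 : seq 'I_j.+1 := map inord (sort geq s).
have t0i : size t0 == i by rewrite size_map size_sort si.
have t0v : map val t0 = sort geq s.
  rewrite -map_comp -[RHS]map_id; apply/eq_in_map => x.
  rewrite mem_sort => /mem_leq_sumn xs /=; rewrite inordK // ltnS -sj //.
have gtot : total geq by move=> x y; exact: leq_total.
rewrite (big_pred1 (Tuple t0i)) // => mu /=; apply/idP/eqP.
  move=> /andP[/and3P[smu _ _] pe]; apply: val_inj => /=.
  apply: (inj_map val_inj); rewrite t0v.
  have gtr : transitive geq by move=> y x z' xy yz; exact: leq_trans yz xy.
  have ganti : antisymmetric geq by move=> x y /andP[xy yx]; apply: anti_leq; apply/andP; split.
  apply: (sorted_eq gtr ganti) => //; first exact: sort_sorted.
  by rewrite perm_sym (perm_trans _ pe) // perm_sort.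
move=> ->; rewrite /= t0v /is_partition sort_sorted //= mem_sort s0 /=.
by rewrite perm_sym perm_sort perm_refl andbT (perm_sumn (permEl (perm_sort _ _))) sj.
Qed.

(** The exponent vectors of [monomial_sym] have a range depending on the
    partition; they are all moved to one common range before summation over
    partitions and exponent vectors is exchanged. *)
Lemma sum_ffun_widen n s L (P : pred ('I_n -> nat)) (G : ('I_n -> nat) -> F) :
  (s <= L)%N -> (forall f, P f -> forall k, (f k <= s)%N) ->
  \sum_(a : {ffun 'I_n -> 'I_s.+1} | P (fun k => val (a k))) G (fun k => val (a k))
  = \sum_(a : {ffun 'I_n -> 'I_L.+1} | P (fun k => val (a k))) G (fun k => val (a k)).
Proof.
move=> sL Ps; have sL' : (s.+1 <= L.+1)%N by [].
pose h (b : {ffun 'I_n -> 'I_s.+1}) := [ffun k => widen_ord sL' (b k)].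
pose h' (a : {ffun 'I_n -> 'I_L.+1}) := [ffun k => inord (a k) : 'I_s.+1].
rewrite [RHS](reindex_onto h h') => [|a Pa]; last first.
  by apply/ffunP => k; apply: val_inj; rewrite !ffunE /= inordK // ltnS (Ps _ Pa).
have hv b : (fun k => val (h b k)) = (fun k => val (b k)).
  by apply/funext => k; rewrite ffunE.
apply: eq_big => [b|b _]; last by rewrite hv.
rewrite hv; case: (P _) => //=; apply/esym/eqP/ffunP => k.
by apply: val_inj; rewrite !ffunE /= inordK.
Qed.

Definition weight n (f : 'I_n -> nat) : F :=
  \prod_(k < n) (k.+1%:R^-1 ^+ f k / (f k)`!%:R).

(** Summing over partitions and then over their monomials amounts to summing
    over all exponent vectors, as the nonzero exponents determine the
    partition. *)
Lemma Eij_sum_weight i j n L : (j <= L)%N ->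
  Eij F i j n = \sum_(a : {ffun 'I_n -> 'I_L.+1} |
     ((\sum_(k < n) (val (a k) != 0))%N == i) && ((\sum_(k < n) val (a k))%N == j))
    weight (fun k => val (a k)).
Proof.
move=> jL; rewrite /Eij.
have part mu : is_partition j (map val (mu : i.-tuple 'I_j.+1)) ->
  monomial_sym (fun k : 'I_n => k.+1%:R^-1) (map val mu) / \prod_(p <- map val mu) p`!%:R
  = \sum_(a : {ffun 'I_n -> 'I_L.+1} | perm_eq (nonzero_parts (fun k => val (a k))) (map val mu))
     weight (fun k => val (a k)).
  move=> /and3P[_ _ /eqP smu].
  rewrite /monomial_sym mulr_suml.
  rewrite -(@sum_ffun_widen n (sumn (map val mu)) L
    (fun f => perm_eq (nonzero_parts f) (map val mu)) (@weight n)) ?smu //.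
    apply: eq_bigr => a pe; rewrite -(perm_big _ pe) prod_fact_nonzero_parts.
    by rewrite -prodf_div.
  move=> f pe k; rewrite -smu -(perm_sumn pe) sumn_nonzero_parts.
  by rewrite (bigD1 k) //= leq_addr.
rewrite (eq_bigr _ part) (exchange_big_dep xpredT) //= [RHS]big_mkcond /=.
apply: eq_bigr => a _; rewrite sum_partitions_perm.
  by rewrite size_nonzero_parts sumn_nonzero_parts.
by rewrite mem_filter eqxx.
Qed.

Definition phi_trunc L q : {poly F} :=
  \sum_(e < L) (q%:R ^+ e.+1 * e.+1`!%:R)^-1 *: 'X^e.

(** Choosing one summand in each factor [1 + z * phi_q (u)] is the same as
    choosing an exponent vector: exponent [0] stands for the summand [1]. *)
Lemma Dr_coef r n L z : (0 < r)%N -> (n + r <= L)%N ->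
  Dr r n z = (\prod_(1 <= q < n.+1) (1 + z *: phi_trunc L q))`_(r - 1).
Proof.
move=> r0 nL.
pose t (k : 'I_n) (e : 'I_L.+1) : {poly F} :=
  if val e == 0%N then 1 else (z * (k.+1%:R^-1 ^+ e / e`!%:R)) *: 'X^(e.-1).
have tE (k : 'I_n) : 1 + z *: phi_trunc L k.+1 = \sum_(e < L.+1) t k e.
  rewrite big_ord_recl /t /= /phi_trunc scaler_sumr; congr (_ + _).
  apply: eq_bigr => e _; rewrite /= scalerA invfM exprVn; congr (_ *: _).
have pE (a : {ffun 'I_n -> 'I_L.+1}) : \prod_(k < n) t k (a k) =
    (z ^+ (\sum_(k < n) (val (a k) != 0))%N * weight (fun k => val (a k)))
      *: 'X^(\sum_(k < n) (val (a k)).-1)%N.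
  rewrite /weight expr_sum expr_sum -big_split /= -scaler_prod.
  apply: eq_bigr => k _; rewrite /t; case: eqP => [->|_].
    by rewrite mul1r fact0 divr1 !expr0 scale1r.
  by rewrite expr1.
rewrite big_add1 /= big_mkord (eq_bigr _ (fun k _ => tE k)) bigA_distr_bigA /=.
rewrite (eq_bigr _ (fun a _ => pE a)) coef_sum /Dr.
under eq_bigr => i _.
  rewrite (@Eij_sum_weight i (i + r - 1) n L); last first.
    by rewrite leq_subLR (leq_trans _ (leq_trans nL (leq_addl _ _))) // leq_add2r -ltnS.
  rewrite mulr_suml big_mkcond.
  over.
rewrite exchange_big /=; apply: eq_bigr => a _.
set N := (\sum_(k < n) _)%N; set S := (\sum_(k < n) val (a k))%N.
have SN : S = ((\sum_(k < n) (val (a k)).-1) + N)%N.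
  rewrite /S /N -big_split /=; apply: eq_bigr => k _.
  by case: (val (a k)) => //= m; rewrite addn1.
have Nn : (N < n.+1)%N.
  rewrite ltnS /N -[leqRHS]card_ord -sum1_card; apply: leq_sum => k _.
  by case: eqP.
rewrite (bigD1 (Ordinal Nn)) //= big1 ?addr0 => [|i iN]; last first.
  case: ifP => // /andP[/eqP Ni _]; move: iN; rewrite -val_eqE /= -Ni eqxx.
  by [].
rewrite eqxx /= coefZ coefXn SN -addnBA // addnC eqn_add2l [(_ == (r - 1)%N)]eq_sym.
by case: eqP => _; rewrite ?mulr1 ?mulr0 // mulrC.
Qed.

End GeneratingFunction.

(** * Asymptotics of the Taylor coefficients in u *)

Section CoefficientAsymptotics.
Variable R : realType.
Implicit Types (z u w c : CC R) (e rho : R).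

Lemma disc_algebra_scale c rho B (a : CC R) (f : CC R -> CC R) :
  disc_algebra 0 B f -> (forall z, cabs (z - c) <= rho -> cabs (a * z) <= B) ->
  disc_algebra c rho (fun z => f (a * z)).
Proof.
move=> fP aB e e0; have [p fp] := fP e e0.
exists (p \Po (a *: 'X)) => z zc.
by rewrite horner_comp hornerZ hornerX fp // subr0 aB.
Qed.

Definition unif_lim (D : set (CC R)) (g : nat -> CC R -> CC R) (f : CC R -> CC R) :=
  forall e, 0 < e -> exists N, forall L, (N <= L)%N ->
    forall u, D u -> cabs (f u - g L u) <= e.

Lemma unif_limM (D : set (CC R)) (g g' : nat -> CC R -> CC R) f f' M M' :
  (forall u, D u -> cabs (f u) <= M) -> (forall u, D u -> cabs (f' u) <= M') ->
  unif_lim D g f -> unif_lim D g' f' ->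
  unif_lim D (fun n u => g n u * g' n u) (fun u => f u * f' u).
Proof.
move=> fM fM' gf gf' e e0; have [d d0 dP] := mul_close M M' e0.
have [N NP] := gf _ d0; have [N' NP'] := gf' _ d0.
exists (maxn N N') => L; rewrite geq_max => /andP[NL NL'] u Du.
by apply: dP; [exact: fM|exact: fM'|exact: NP|exact: NP'].
Qed.

Lemma horner_phi_trunc L q u :
  (phi_trunc (CC R) L q).[u] = \sum_(e < L) u ^+ e / (q%:R ^+ e.+1 * e.+1`!%:R).
Proof.
rewrite horner_sum; apply: eq_bigr => e _.
by rewrite hornerZ hornerXn mulrC.
Qed.

(** Dividing by [u] is harmless because the tail of the exponential series
    vanishes at [0] to a high order. *)
Lemma phi_trunc_rate L q u : (0 < q)%N -> (0 < L)%N -> cabs u <= 1 ->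
  cabs (phi q u - (phi_trunc (CC R) L q).[u]) <= 2 * expR 2 / L.+1%:R.
Proof.
move=> q0 L0 u1; rewrite horner_phi_trunc.
have E2 := expR_gt0 (2 : R).
have qC : q%:R != 0 :> CC R by rewrite pnatr_eq0 -lt0n.
rewrite /phi; case: eqP => [->|/eqP u0].
  case: L L0 => // L _; rewrite big_ord_recl /= expr0 expr1 mulr1 mul1r.
  rewrite big1 => [|i _]; last by rewrite expr0n /= mul0r.
  by rewrite addr0 subrr cabs0 divr_ge0 // mulr_ge0 // ltW.
pose w := u / q%:R.
have wu : cabs w <= cabs u.
  rewrite cabsM cabsV cabs_nat ler_pdivrMr ?ltr0n //.
  by rewrite ler_peMr ?cabs_ge0 // ler1n.
have w1 := le_trans wu u1.
have -> : (cexp (u / q%:R) - 1) / u - \sum_(e < L) u ^+ e / (q%:R ^+ e.+1 * e.+1`!%:R) =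
    (cexp w - \sum_(k < L.+1) w ^+ k / k`!%:R) / u.
  rewrite big_ord_recl /= expr0 fact0 divr1 opprD addrA [RHS]mulrBl; congr (_ - _).
  rewrite mulr_suml; apply: eq_bigr => e _.
  rewrite /bump add1n /w expr_div_n invfM [u ^+ e.+1]exprS.
  by apply: (mulIf u0); rewrite divfK //; ring.
have up : 0 < cabs u by rewrite cabs_gt0.
rewrite cabsM cabsV ler_pdivrMr //.
apply: le_trans (cexp_taylor L.+1 w1) _.
rewrite -[_ / _ * _]mulrA ler_pM2l ?mulr_gt0 //.
rewrite expr_div_n mulrC ler_pM ?invr_ge0 ?exprn_ge0 ?cabs_ge0 //.
  by rewrite lef_pV2 ?posrE ?exprn_gt0 ?ltr0n // -natrX ler_nat ltnW // ltn_expl.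
by rewrite exprS (le_trans _ wu) // ler_piMr ?cabs_ge0 // exprn_ile1 ?cabs_ge0.
Qed.

Definition udisc : set (CC R) := [set u | cabs (u - 0) <= 1].

Section FixedZ.
Variable z : CC R.
Hypothesis z1 : cabs (z - 1) <= 2^-1.

(** The [n]-th partial product of [Rprod] with truncated exponential series:
    a polynomial in [u]. *)
Definition Rpoly n L : {poly CC R} :=
  \prod_(1 <= q < n.+1) ((1 + z *: phi_trunc (CC R) L q) * ((1 + z / q%:R)^-1)%:P).

Lemma factor_unif_lim q : (0 < q)%N ->
  unif_lim udisc
    (fun L u => ((1 + z *: phi_trunc (CC R) L q) * ((1 + z / q%:R)^-1)%:P).[u])
    (fun u => (1 + z * phi q u) / (1 + z / q%:R)).
Proof.
move=> q0 e e0; have [N NP] := exists_rate_lt (2 * (2 * expR 2)) e0.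
exists N.+1 => L NL u; rewrite /udisc /= subr0 => u1.
have E2 := expR_gt0 (2 : R).
rewrite hornerM hornerC hornerD hornerC hornerZ -mulrBl.
have -> : 1 + z * phi q u - (1 + z * (phi_trunc (CC R) L q).[u]) =
  z * (phi q u - (phi_trunc (CC R) L q).[u]) by ring.
have d1 := disc_denom z1 q.
rewrite cabsM cabsV ler_pdivrMr ?(lt_le_trans _ d1) //.
apply: le_trans (_ : e <= _); last by rewrite ler_peMr // ltW.
rewrite cabsM; apply: le_trans (ltW NP).
rewrite -mulrA ler_pM ?cabs_ge0 ?disc_cabs //.
rewrite (le_trans (phi_trunc_rate q0 _ u1)) ?(leq_ltn_trans _ NL) //.
rewrite ler_pM2l ?mulr_gt0 // lef_pV2 ?posrE ?ltr0n // ler_nat ltnS.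
exact: ltnW.
Qed.

Lemma unif_lim_disc_algebra (f : CC R -> CC R) (p : nat -> {poly CC R}) :
  unif_lim udisc (fun L u => (p L).[u]) f -> disc_algebra 0 1 f.
Proof. by move=> H e /H[N NP]; exists (p N) => u; apply: NP. Qed.

Lemma Rpart_unif_lim n :
  unif_lim udisc (fun L u => (Rpoly n L).[u]) (fun u => Rpart z u n).
Proof.
elim: n => [|n IH].
  move=> e e0; exists 0%N => L _ u _.
  by rewrite /Rpoly /Rpart !big_geq // hornerC subrr cabs0 ltW.
have [M fM] := disc_algebra_bounded (unif_lim_disc_algebra IH).
have step := factor_unif_lim (ltn0Sn n).
have [M' fM'] := disc_algebra_bounded (unif_lim_disc_algebra step).
have := unif_limM fM fM' IH step.
move=> H e /H[N NP]; exists N => L NL u Du.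
by rewrite /Rpoly /Rpart !(big_nat_recr n.+1) //= hornerM; apply: NP.
Qed.

Lemma Rpoly_coef r n L : (0 < r)%N -> (n + r <= L)%N ->
  (Rpoly n L)`_(r - 1) = Dr r n z / \prod_(1 <= q < n.+1) (1 + z / q%:R).
Proof.
move=> r0 nL; rewrite (Dr_coef _ r0 nL) /Rpoly big_split /=.
by rewrite -rmorph_prod /= coefMC prodfV.
Qed.

Lemma Rprod_disc_algebra : disc_algebra 0 1 (fun u => Rprod u z).
Proof.
apply: disc_algebra_limit => e e0.
have [n ne] := exists_rate_lt (Rpart_const R) e0.
exists (fun u => Rpart z u n).
  by apply: (@unif_lim_disc_algebra _ (Rpoly n)); exact: Rpart_unif_lim.
move=> u; rewrite subr0 => u1.
have [_ H] := Rpart_cvg z1 n u1.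
by rewrite cabsB (le_trans H) // ltW.
Qed.

End FixedZ.

Lemma Rpart_const_ge0 : 0 <= Rpart_const R.
Proof. by rewrite /Rpart_const !mulr_ge0 ?expR_ge0 // ltW // exp_const_gt0. Qed.

(** Extraction of a Taylor coefficient is continuous for the uniform norm on
    the unit disc, with a constant independent of [z]. It is applied to the
    infinite product and to the polynomial [Rpoly n L], where [L] is so large
    that the error is [O (1 / n)] and the coefficient is exactly [Dr] up to
    normalisation. *)
Lemma taylor_Rprod_rate r : (0 < r)%N -> exists2 C, 0 <= C &
  forall z, cabs (z - 1) <= 2^-1 ->
    cabs (taylor_coef (r - 1) (fun u => Rprod u z)) <= C /\
    forall n, cabs (taylor_coef (r - 1) (fun u => Rprod u z) -
       Dr r n z / \prod_(1 <= q < n.+1) (1 + z / q%:R)) <= C / n.+1%:R.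
Proof.
move=> r0; set m := (r - 1)%N.
have [C C0 CP] := @disc_algebra_derive1n R m 0 1 0 ltr01.
have K0 := Rpart_const_ge0.
exists (C * (Rpart_const R + 1)); first by rewrite mulr_ge0 // addr_ge0.
move=> z z1; have RA := Rprod_disc_algebra z1.
have [_ _ H] := CP _ RA.
have zero : cabs (0 - 0 : CC R) <= 0 by rewrite subrr cabs0.
have mf : 1 <= m`!%:R :> R by rewrite ler1n fact_gt0.
have key p e : (forall u, cabs (u - 0) <= 1 -> cabs (Rprod u z - p.[u]) <= e) ->
    cabs (taylor_coef m (fun u => Rprod u z) - p`_m) <= C * e.
  move=> pe; have h := H p e pe 0 zero.
  rewrite coef_derivn_at0 /taylor_coef -mulrBl cabsM cabsV cabs_nat.
  rewrite ler_pdivrMr ?(lt_le_trans _ mf) //.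
  apply: le_trans h _; rewrite ler_peMr // mulr_ge0 //.
  by apply: le_trans (pe 0 _); rewrite ?cabs_ge0 // subrr cabs0.
split.
  have := key 0 (Rpart_const R + 1); rewrite coef0 subr0; apply => u.
  rewrite subr0 horner0 subr0 => u1.
  have [_] := Rpart_cvg z1 0 u1; rewrite divr1 /Rpart big_geq // => h.
  by rewrite (le_trans (cabs_triB _ 1)) // cabs1 addrC lerD2r cabsB.
move=> n; have n0 : 0 < n.+1%:R^-1 :> R by rewrite invr_gt0 ltr0n.
have [N NP] := Rpart_unif_lim z1 n n0.
(* [n + r] makes the coefficient exact, [N] makes the truncation error small. *)
pose L := maxn N (n + r).
rewrite -(@Rpoly_coef z r n L) ?leq_maxr // -mulrA.
apply: key => u u1; rewrite mulrDl mul1r.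
rewrite (le_trans (cabs_tri _ (Rpart z u n) _)) // lerD //; last first.
  by apply: NP => //; exact: leq_maxl.
rewrite subr0 in u1; have [_] := Rpart_cvg z1 n u1.
by rewrite cabsB.
Qed.

Lemma prod_succ n : \prod_(1 <= q < n.+1) (1 + 1 / q%:R) = n.+1%:R :> CC R.
Proof.
elim: n => [|n IH]; first by rewrite big_geq.
rewrite big_nat_recr //= IH mulrDr mulr1 mul1r divff ?pnatr_eq0 //.
by rewrite natr1.
Qed.

(** All coefficients are nonnegative, so it is enough to take the term
    ['X^m] from the factor [q = 1] and the constant terms [1 + 1 / q] from the
    others; their product over [2 <= q <= n + 1] telescopes to
    [(n + 2) / 2]. *)
Lemma coef_prod_phi_trunc_ge (K : numFieldType) L m n : (m < L)%N ->
  [/\ forall k, 0 <= (\prod_(1 <= q < n.+2) (1 + phi_trunc K L q))`_k &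
   n.+2%:R / 2 / m.+1`!%:R <= (\prod_(1 <= q < n.+2) (1 + phi_trunc K L q))`_m].
Proof.
move=> mL.
have phi_coef q k : (phi_trunc K L q)`_k = if (k < L)%N then (q%:R ^+ k.+1 * k.+1`!%:R)^-1 else 0.
  rewrite coef_sum; case: ifPn => [kL|kL].
    rewrite (bigD1 (Ordinal kL)) //= big1 ?addr0 => [|i].
      by rewrite coefZ coefXn eqxx mulr1.
    by rewrite -val_eqE /= coefZ coefXn eq_sym => /negbTE ->; rewrite mulr0.
  rewrite big1 // => i _; rewrite coefZ coefXn eq_sym.
  by case: eqP => [E|_]; rewrite ?mulr0 //; move: kL; rewrite -E ltn_ord.
have fac_ge0 q k : 0 <= (1 + phi_trunc K L q)`_k.
  by rewrite coefD coef1 addr_ge0 // phi_coef; case: ifP => _ //;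
    rewrite ?invr_ge0 ?mulr_ge0 ?exprn_ge0.
elim: n => [|n [IH1 IH2]].
  rewrite big_nat1; split => // ; rewrite coefD phi_coef mL expr1n mul1r.
  by rewrite divff ?pnatr_eq0 // mul1r lerDr coef1.
rewrite big_nat_recr //=; split.
  move=> k; rewrite coefM; apply: sumr_ge0 => i _.
  by rewrite mulr_ge0.
rewrite coefM (bigD1 ord_max) //= subnn.
set P := \prod_(1 <= q < n.+2) _ in IH1 IH2 *.
apply: le_trans (_ : P`_m * (1 + phi_trunc K L n.+2)`_0 <= _); last first.
  by rewrite lerDl; apply: sumr_ge0 => i _; rewrite mulr_ge0.
have -> : (1 + phi_trunc K L n.+2)`_0 = 1 + n.+2%:R^-1.
  by rewrite coefD coef1 phi_coef (leq_ltn_trans _ mL) // expr1 mulr1.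
have -> : n.+3%:R / 2 / m.+1`!%:R = n.+2%:R / 2 / m.+1`!%:R * (1 + n.+2%:R^-1) :> K.
  have -> : n.+3%:R = n.+2%:R * (1 + n.+2%:R^-1) :> K.
    by rewrite mulrDr mulr1 divff ?pnatr_eq0 // natr1.
  by ring.
by rewrite ler_wpM2r // addr_ge0 // invr_ge0.
Qed.

(** [Cr] is the limit of [Dr r n 1 / (n + 1)], which is bounded away from
    [0]. *)
Lemma Cr_neq0 r : (0 < r)%N -> Cr R r != 0.
Proof.
move=> r0; have [C C0 CP] := taylor_Rprod_rate r0.
have z1 : cabs (1 - 1 : CC R) <= 2^-1 by rewrite subrr cabs0 invr_ge0.
have [_ H] := CP 1 z1.
pose c : R := 2^-1 / (r - 1).+1`!%:R.
have c0 : 0 < c by rewrite divr_gt0 ?invr_gt0 // ltr0n fact_gt0.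
have [n ne] := exists_rate_lt C c0.
have := H n.+1; rewrite prod_succ -/(Cr R r) => h.
rewrite -cabs_gt0.
have lo : c <= cabs (Dr r n.+1 1 / n.+2%:R : CC R).
  rewrite cabsM cabsV cabs_nat ler_pdivlMr ?ltr0n //.
  rewrite (@Dr_coef _ r n.+1 (n.+1 + r) 1) //.
  under eq_bigr do rewrite scale1r.
  have mL : (r - 1 < n.+1 + r)%N by rewrite subn1 prednK // leq_addl.
  have [ge0 ge] := @coef_prod_phi_trunc_ge (CC R) (n.+1 + r) (r - 1) n mL.
  rewrite -lecR -normCE.
  have -> : (c * n.+2%:R)%:C = n.+2%:R / 2 / (r - 1).+1`!%:R :> CC R.
    by rewrite /c !realCM !realCV !realC_nat; ring.
  by rewrite (le_trans ge) // ger0_norm ?ge0.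
have h' : C / n.+2%:R <= C / n.+1%:R.
  by rewrite ler_wpM2l // lef_pV2 ?posrE ?ltr0n // ler_nat.
rewrite cabsB in h.
have t := cabs_triB (Dr r n.+1 1 / n.+2%:R : CC R) (Cr R r).
rewrite -(ltrD2r (C / n.+1%:R)) add0r (lt_le_trans ne) // (le_trans lo) // (le_trans t) //.
by rewrite lerD2l (le_trans h).
Qed.

End CoefficientAsymptotics.

(** * The remainder and its derivatives *)

Section Remainder.
Variable R : realType.
Implicit Types (z u w c : CC R) (e rho : R).

Lemma cpowK (t : R) z : cpow t z * cpow t (- z) = 1.
Proof. by rewrite /cpow mulNr cexpK. Qed.

Definition remainder r n z : CC R := Dr r n z * cpow n%:R (- z) - Kr r z.

(** Dividing and multiplying by the product of the [1 + z / q] splits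
    [Dr r n z * n ^ (- z)] into a ratio tending to the Taylor coefficient of
    [Rprod] and [gauss_part n z], which tends to [1 / Gamma (1 + z)]. *)
Lemma remainder_rate r : (0 < r)%N -> exists K, forall n z,
  cabs (z - 1) <= 2^-1 -> cabs (remainder r n z) <= K / n.+1%:R.
Proof.
move=> r0; have [C C0 CP] := taylor_Rprod_rate R r0.
pose E := expR (2 * gauss_const R).
exists (C * E + C * (2 * gauss_const R * E)) => n z z1; rewrite /E.
have [TC /(_ n) TD] := CP z z1; have [GE GL] := gauss_part_cvg n (disc_cabs z1).
set T := taylor_coef _ _ in TC TD; set P := \prod_(1 <= q < n.+1) (1 + z / q%:R) in TD.
have -> : remainder r n z =
    - (T - Dr r n z / P) * gauss_part n z + T * (gauss_part n z - gauss_lim z).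
  have P0 : P != 0.
    rewrite /P big_add1 /= big_mkord; apply/prodf_neq0 => k _.
    exact: disc_denom_neq0.
  rewrite /remainder /Kr (invr_Gamma z1) -/T /gauss_part -/P.
  have -> : - (T - Dr r n z / P) * (P * cpow n%:R (- z)) =
    - (T * (P * cpow n%:R (- z))) + Dr r n z / P * P * cpow n%:R (- z) by ring.
  by rewrite divfK //; ring.
rewrite (le_trans (cabsD _ _)) // (cabsM (- _)) (cabsM T) cabsN.
apply: le_trans (lerD (ler_pM (cabs_ge0 _) (cabs_ge0 _) TD GE)
  (ler_pM (cabs_ge0 _) (cabs_ge0 _) TC GL)) _.
by rewrite le_eqVlt; apply/orP; left; apply/eqP; ring.
Qed.

(** [Kr] is itself a uniform limit of the functions [Dr r k z * k ^ (- z)],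
    each a polynomial times an exponential; this avoids a direct study of the
    Gamma function as a holomorphic function. *)
Lemma remainder_disc_algebra r n : (0 < r)%N ->
  disc_algebra 1 2^-1 (fun z => remainder r n z).
Proof.
move=> r0.
have lead k : disc_algebra 1 2^-1 (fun z => Dr r k z * cpow k%:R (- z)).
  apply: disc_algebraM.
    have := disc_algebra_poly 1 2^-1 (\sum_(i < k.+1) Eij (CC R) i (i + r - 1) k *: 'X^i).
    apply: disc_algebra_ext => z _; rewrite horner_sum; apply: eq_bigr => i _.
    by rewrite hornerZ hornerXn.
  pose a : CC R := - (ln k%:R)%:C.
  have B0 : 0 < cabs a * 2 + 1 by rewrite ltr_wpDl // mulr_ge0 // cabs_ge0.
  have := @disc_algebra_scale R 1 2^-1 (cabs a * 2 + 1) a (@cexp R) (disc_algebra_cexp B0).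
  have bound z : cabs (z - 1) <= 2^-1 -> cabs (a * z) <= cabs a * 2 + 1.
    move=> z1; rewrite cabsM (le_trans (_ : _ <= cabs a * 2)) ?lerDl //.
    by rewrite ler_wpM2l ?cabs_ge0 // disc_cabs.
  move=> /(_ bound); apply: disc_algebra_ext => z _.
  by rewrite /cpow /a mulNr mulrC mulNr.
apply: disc_algebraB => //; apply: disc_algebra_limit => e e0.
have [K KP] := remainder_rate r0; have [k ke] := exists_rate_lt K e0.
exists (fun z => Dr r k z * cpow k%:R (- z)) => // z z1.
by rewrite cabsB (le_trans (KP k z z1)) // ltW.
Qed.

Lemma gauss_lim1 : gauss_lim 1 = 1 :> CC R.
Proof.
apply: cvg_lim; first exact: norm_hausdorff.
apply/cvg_cabsP => e e0; have [N NP] := exists_rate_lt 1 e0.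
exists N.+1 => n Nn; have n0 : (0 < n)%N := leq_ltn_trans (leq0n _) Nn.
have nC : n%:R != 0 :> CC R by rewrite pnatr_eq0 -lt0n.
rewrite /gauss_part prod_succ.
have -> : cpow n%:R (- 1) = n%:R^-1 :> CC R.
  rewrite /cpow mulNr mul1r cexpN cexp_real lnK ?posrE ?ltr0n // realC_nat.
  by [].
have -> : n.+1%:R / n%:R - 1 = n%:R^-1 :> CC R.
  by rewrite -natr1 mulrDl divff // mul1r addrAC subrr add0r.
rewrite cabsV cabs_nat; apply: le_lt_trans NP; rewrite mul1r.
by rewrite lef_pV2 ?posrE ?ltr0n // ler_nat.
Qed.

Lemma Kr1 r : Kr r 1 = Cr R r.
Proof.
rewrite /Kr invr_Gamma ?gauss_lim1 ?mul1r // subrr cabs0 invr_ge0.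
by [].
Qed.

Lemma Dr1_equiv r : (0 < r)%N ->
  (fun n : nat => Dr r n (1 : CC R)) ~_\oo (fun n : nat => Cr R r * n%:R).
Proof.
move=> r0; have [K KP] := remainder_rate r0.
have C0 : 0 < cabs (Cr R r) by rewrite cabs_gt0 Cr_neq0.
apply/eqaddoP => eps eps0.
have epsE : eps = (complex.Re (eps : R[i]))%:C.
  by rewrite (RRe_real (ger0_real (ltW eps0))).
move: eps0; rewrite epsE; move: (complex.Re _) => e; rewrite ltcR => e0.
have [N NP] := exists_rate_lt K (mulr_gt0 e0 C0).
exists (maxn N 1) => // n /=; rewrite geq_max => /andP[Nn n1].
rewrite !normCE -realCM lecR !fctE.
have nR : 0 < n%:R :> R by rewrite ltr0n.
have -> : Dr r n 1 - Cr R r * n%:R = remainder r n 1 * n%:R.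
  have cn : cpow n%:R (- 1) * n%:R = 1 :> CC R.
    rewrite /cpow mulNr mul1r cexpN cexp_real lnK ?posrE // realC_nat.
    by rewrite mulVf // pnatr_eq0 -lt0n.
  rewrite /remainder Kr1 [RHS]mulrBl; congr (_ - _).
  by rewrite -[RHS]mulrA cn mulr1.
rewrite (cabsM (remainder _ _ _)) (cabsM (Cr R r)) cabs_nat mulrA ler_pM2r //.
have z1 : cabs (1 - 1 : CC R) <= 2^-1 by rewrite subrr cabs0 invr_ge0.
have K0 : 0 <= K by have := KP 0%N 1 z1; rewrite divr1; apply: le_trans; exact: cabs_ge0.
rewrite (le_trans (KP n 1 z1)) // (le_trans _ (ltW NP)) //.
by rewrite ler_wpM2l // lef_pV2 ?posrE ?ltr0n // ler_nat ltnS.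
Qed.

Lemma locally_uniformly_cst0 (U : set (CC R)) (f : nat -> CC R -> CC R) K :
  open U -> (forall n z, U z -> cabs (f n z) <= K / n.+1%:R) ->
  locally_uniformly U f (cst 0).
Proof.
move=> oU fK z Uz; exists U; first exact: open_nbhs_nbhs.
move=> P /uniform_nbhs[E [entE EP]].
have /nbhs_cabsP[e e0 eE] := nbhs_entourage (0 : CC R) entE.
have [N NP] := exists_rate_lt K e0.
have K0 : 0 <= K.
  by have := fK 0%N z Uz; rewrite divr1; apply: le_trans; exact: cabs_ge0.
exists N => // n /= Nn; apply: EP => w Uw; have : xsection E 0 (f n w).
  apply: eE; rewrite subr0 (le_lt_trans (fK n w Uw)) // (le_lt_trans _ NP) //.
  by rewrite ler_wpM2l // lef_pV2 ?posrE ?ltr0n // ler_nat ltnS.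
by rewrite /xsection /= inE.
Qed.

Lemma open_disc (c : CC R) rho : open [set z | cabs (z - c) < rho].
Proof.
rewrite openE => z /= zr; apply/nbhs_cabsP; exists (rho - cabs (z - c)).
  by rewrite subr_gt0.
move=> w wz; rewrite /= (le_lt_trans (cabs_tri _ z _)) //; lra.
Qed.

End Remainder.

Theorem theorem3p2 (R : realType) (r : nat) (hr : (1 <= r)%N) :
  (exists U : set (CC R), [/\ open U, U 1 &
     exists eps : nat -> CC R -> CC R,
       (forall (n : nat) (z : CC R), (1 <= n)%N -> U z ->
          Dr r n z = cpow n%:R z * (Kr r z + eps n z)) /\
       (forall k : nat,
          (forall (n : nat) (z : CC R), (1 <= n)%N -> U z ->
             derivable (derive1n k (eps n)) z 1) /\
          locally_uniformly U (fun n => derive1n k (eps n)) (cst 0))]) /\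
  (fun n : nat => Dr r n (1 : CC R)) ~_\oo (fun n : nat => Cr R r * n%:R).
Proof.
split; last exact: Dr1_equiv.
have [K KP] := remainder_rate R hr.
have q0 : 0 < 4^-1 :> R by rewrite invr_gt0.
have qh : 4^-1 < 2^-1 :> R by lra.
exists [set z | cabs (z - 1) < 4^-1]; split.
- exact: open_disc.
- by rewrite /= subrr cabs0.
exists (remainder r); split => [n z _ _|k].
  by rewrite /remainder subrKC mulrCA cpowK mulr1.
have [C C0 CP] := @disc_algebra_derive1n R k 1 2^-1 4^-1 qh.
split => [n z _ /ltW z1|].
  by have [_ H _] := CP _ (remainder_disc_algebra n hr); exact: H.
apply: (@locally_uniformly_cst0 _ _ _ (C * K)); first exact: open_disc.
move=> n z /ltW z1.
have [_ _ H] := CP _ (remainder_disc_algebra n hr).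
have := H 0 (K / n.+1%:R) _ z z1.
rewrite linear0 horner0 subr0 mulrA; apply => w w1.
by rewrite horner0 subr0 KP.
Qed.
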